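(* Let $p\in\mathcal P$. There is a constant $C>0$ (independent of $f$) such that for every martingale $f=(f_n)_{n\ge 0}\in H^s_{p(\cdot)}$ there exist a sequence $(a^k)_{k\in\mathbb Z}$ of $p$-$A_1$ atoms with $\|a^k\|_{H^s_{p(\cdot)}}\le 1$ for all $k$, and a sequence $(\theta_k)_{k\in\mathbb Z}$ of nonnegative numbers, such that $$f_n=\sum_{k\in\mathbb Z}\theta_k E_n a^k\quad\text{a.e., for all } n\ge 0,$$ and $$C^{-1}\Big(\sum_{k\in\mathbb Z}\theta_k^{p^+}\Big)^{1/p^+}\le \|f\|_{H^s_{p(\cdot)}}\le C\Big(\sum_{k\in\mathbb Z}\theta_k^{p^-}\Big)^{1/p^-}.$$ Moreover, the sum $\sum_{k=j}^m\theta_k a^k$ converges to $f$ in $H^s_{p(\cdot)}$ as $j\to-\infty$, $m\to\infty$.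
   Context: $(\Omega,\Sigma,\mu)$ is a complete probability space with expectation $E$. $\mathcal P$ is the set of measurable $p:\Omega\to(0,\infty)$ with $0<p^-\le p^+<\infty$, where $p^-=\operatorname{ess\,inf}p$ and $p^+=\operatorname{ess\,sup}p$. For $p\in\mathcal P$ and measurable $u$, $\rho_{p(\cdot)}(u)=E(|u|^{p})=\int_\Omega|u(\omega)|^{p(\omega)}d\mu$, and $\|u\|_{p(\cdot)}=\inf\{\gamma>0:\rho_{p(\cdot)}(u/\gamma)\le 1\}$ (with $\inf\emptyset=\infty$); $L^{p(\cdot)}$ is the set of $u$ with $\|u\|_{p(\cdot)}<\infty$. $(\Sigma_n)_{n\ge0}$ is a nondecreasing sequence of sub-$\sigma$-algebras of $\Sigma$ with $\Sigma=\bigvee_n\Sigma_n$, and $\Sigma_{-1}=\{\Omega,\emptyset\}$. $E_n$ is conditional expectation with respect to $\Sigma_n$. For a martingale $f=(f_n)_{n\ge0}$ adapted to $(\Sigma_n)$, put $f_{-1}=0$, $d_nf=f_n-f_{n-1}$ for $n\ge0$, and define the conditional square function $s(f)=\big(\sum_{n\ge0}E_{n-1}|d_nf|^2\big)^{1/2}$. Then $\|f\|_{H^s_{p(\cdot)}}=\|s(f)\|_{p(\cdot)}$ and $H^s_{p(\cdot)}=\{f:\|f\|_{H^s_{p(\cdot)}}<\infty\}$. An integrable function $a$ is identified with the martingale $(E_na)_{n\ge0}$. A $\Sigma$-measurable (integrable) function $a$ is a $p$-$A_1$ atom (atom of first category) if there is a stopping time $\tau$ with respect to $(\Sigma_n)_{n\ge-1}$,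 with values in $\{-1,0,1,\dots\}\cup\{\infty\}$, such that (1) for every $n\ge0$, $E_na=0$ on the set $\{n\le\tau\}$; and (2) $\|s(a)\|_\infty\le\|\chi_{\{\tau<\infty\}}\|_{p(\cdot)}^{-1}$. Convergence of $\sum_{k=j}^m\theta_ka^k$ to $f$ in $H^s_{p(\cdot)}$ means $\big\|f-\sum_{k=j}^m\theta_ka^k\big\|_{H^s_{p(\cdot)}}\to0$, where the sum denotes the martingale $\big(\sum_{k=j}^m\theta_kE_na^k\big)_{n\ge0}$. *)

(* Defs.v *)
From HB Require Import structures.
From mathcomp Require Import all_boot all_order all_algebra.
From mathcomp Require Import all_classical all_reals all_analysis.
From mathcomp Require Import measurable_realfun ess_sup_inf hoelder.
Set Implicit Arguments.
Unset Strict Implicit.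
Unset Printing Implicit Defensive.
Import Order.TTheory GRing.Theory Num.Theory.
Import numFieldNormedType.Exports.
Local Open Scope classical_set_scope.
Local Open Scope ring_scope.

Section variable_exponent.
Context d (T : measurableType d) (R : realType) (P : probability T R).
Implicit Types (p : T -> R) (u : T -> \bar R).

Definition pminus p : R := fine (ess_inf P (EFin \o p)).
Definition pplus p : R := fine (ess_sup P (EFin \o p)).

Definition is_exponent p : Prop :=
  [/\ measurable_fun setT p, forall w, 0 < p w,
      (0 < ess_inf P (EFin \o p))%E & (ess_sup P (EFin \o p) < +oo)%E].

(* Functions are extended-real valued because the conditional square function
   of an arbitrary martingale may be infinite. *)
Definition rho p u : \bar R := (\int[P]_w (`|u w| `^ p w))%E.

(* The infimum of the empty set is +oo. *)
Definition vnorm p u : \bar R :=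
  ereal_inf [set g%:E | g in
    [set g : R | 0 < g /\ (rho p (fun w => u w * (g^-1)%:E) <= 1)%E]].

End variable_exponent.

Section conditional_expectation.
Context d (T : measurableType d) (R : realType) (P : probability T R).
Implicit Types (G : set (set T)) (X Y : T -> \bar R).

Definition measurable_wrt d' (T' : measurableType d') G (f : T -> T') : Prop :=
  forall B, measurable B -> G (f @^-1` B).

(* Y is a version of the conditional expectation of X given G. This covers
   integrable X as well as nonnegative X with possibly infinite integral; in
   both cases Y exists and is unique almost everywhere. *)
Definition is_condexp G X Y : Prop :=
  [/\ measurable_wrt G Y,
      (forall w, (0 <= X w)%E) -> (forall w, (0 <= Y w)%E) &
      forall A, G A -> (\int[P]_(w in A) Y w = \int[P]_(w in A) X w)%E].

Definition condexp G X : T -> \bar R := xget (cst 0%E) (is_condexp G X).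

(* For integrable a, a version of condexp is finite almost everywhere, so that
   fine alters it on a null set only. *)
Definition condexpR G (a : T -> R) : T -> R :=
  fine \o condexp G (EFin \o a).

End conditional_expectation.

Section martingales.
Context d (T : measurableType d) (R : realType) (P : probability T R).
Variable F : nat -> set (set T).
Implicit Types (p a : T -> R) (f : nat -> T -> R) (tau : T -> \bar int).

Definition is_filtration : Prop :=
  [/\ forall n, sigma_algebra setT (F n),
      forall n, F n `<=` measurable,
      forall m n, (m <= n)%N -> F m `<=` F n &
      (@measurable _ T) = <<s \bigcup_n F n >>].

(* The filtration extended to index -1 by the trivial sigma-algebra; indices
   below -1 are not used. *)
Definition filt (k : int) : set (set T) :=
  match k with
  | Posz n => F n
  | Negz _ => [set set0; setT]
  end.

Definition is_martingale f : Prop :=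
  [/\ forall n, measurable_wrt (F n) (f n),
      forall n, P.-integrable setT (EFin \o f n) &
      forall m n, (m <= n)%N ->
        {ae P, forall w, condexpR P (F m) (f n) w = f m w}].

Definition mdiff f (n : nat) : T -> R :=
  match n with
  | 0%N => f 0%N
  | m.+1 => fun w => f m.+1 w - f m w
  end.

Definition csquare f : T -> \bar R := fun w =>
  ((\sum_(0 <= n <oo)
     condexp P (filt (n%:Z - 1)) (fun v => (`|mdiff f n v| ^+ 2)%:E) w)
   `^ (2^-1))%E.

Definition Hs_norm p f : \bar R := vnorm P p (csquare f).

Definition mart_of a : nat -> T -> R := fun n => condexpR P (F n) a.

Definition is_stopping_time tau : Prop :=
  (forall w, ((-1)%:E <= tau w)%E) /\
  (forall k : int, -1 <= k -> filt k [set w | (tau w <= k%:E)%E]).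

(* If tau is infinite almost everywhere, the norm of the indicator is 0 and
   its inverse in the extended reals is +oo. *)
Definition is_atom1 p a : Prop :=
  P.-integrable setT (EFin \o a) /\
  exists tau, [/\ is_stopping_time tau,
    forall n : nat,
      {ae P, forall w, (n%:Z%:E <= tau w)%E -> condexpR P (F n) a w = 0} &
    (Lnorm P +oo (csquare (mart_of a))
      <= (vnorm P p (EFin \o \1_[set w | tau w < +oo]))^-1)%E].

End martingales.

(* The sum of u k over the integers k with - j <= k <= m. *)
Definition zsum (R : realType) (u : int -> R) (j m : nat) : R :=
  \sum_(i < (j + m).+1) u (i%:Z - j%:Z).

(* Main.v *)
Require Import Defs.
From HB Require Import structures.
From mathcomp Require Import all_boot all_order all_algebra.
From mathcomp Require Import all_classical all_reals all_analysis.
From mathcomp Require Import measurable_realfun ess_sup_inf hoelder.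
From mathcomp Require Import lra ring zify.
Set Implicit Arguments.
Unset Strict Implicit.
Unset Printing Implicit Defensive.
Import Order.TTheory GRing.Theory Num.Theory.
Import numFieldNormedType.Exports.
Local Open Scope classical_set_scope.
Local Open Scope ring_scope.

(* Let s be the conditional square function of f, s_n its partial sums and
   tau_k = inf {n >= -1 : s_(n+1) > 2^k}. Up to a scalar, the k-th atom is the
   difference of f stopped at tau_(k+1) and at tau_k. Its increments are those
   of f on the predictable sets {2^k < s_n <= 2^(k+1)}, so its conditional square
   function is at most 2^(k+1); hence it is bounded in L^2, and orthogonality of
   the increments makes it converge in L^1, which closes it.
   With theta_k = 2^(k+1) ||1_{s > 2^k}||, both norm inequalities are statements
   about the function s alone: summing a geometric series in k,
   E(s / lambda)^p is comparable to the sum over k of E[(2^k / lambda)^p; s > 2^k],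
   and each of these terms lies between the powers p^+ and p^- of
   2^k ||1_{s > 2^k}|| / lambda up to constants, as long as they are at most 1. *)

(** When p^- < 1 the functional [vnorm] may fail to be subadditive, and no triangle inequality is
    used: every estimate is a pointwise comparison carried through the modular [rho]. The remainder
    of the series is treated in the same way, by dominated convergence of the modular. The band at
    time n is cut out by s_n, which contains the term of index n and is nevertheless known at time n
    - 1. Stopping therefore overshoots nothing, without any bound on the increments of f. These
    increments need not be square integrable. Hence the conditional expectations of |d_n f|^2 are
    those of nonnegative functions with possibly infinite integral, and orthogonality becomes
    available only after restriction to a band. For fixed n and almost every w the partial sums of
    the atomic series are eventually equal to f_n: where 0 < s_q < oo, finitely many levels separate
    s_q from 0 and oo, and where s_q = 0 the increment d_q f vanishes. *)

Lemma integral_indic_mul d (T : measurableType d) (R : realType)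
    (mu : {measure set T -> \bar R}) (A D : set T) (f : T -> \bar R) :
  (\int[mu]_(w in A `&` D) f w = \int[mu]_(w in A) (f w * (\1_D w)%:E))%E.
Proof.
rewrite integral_mkcondr; apply: eq_integral => w _.
by rewrite patchE indicE; case: ifPn => _; rewrite ?mule1 ?mule0.
Qed.

(** * Conditional expectation *)

Section sub_sigma_algebra.
Context d (T : measurableType d) (R : realType) (P : probability T R).
Context (G : set (set T)) (sG : sigma_algebra setT G)
  (GM : G `<=` @measurable _ T).
Local Notation TG := (g_sigma_algebraType G).
Local Open Scope ereal_scope.

Lemma measurable_TG (A : set T) : measurable (A : set TG) <-> G A.
Proof. by rewrite /measurable /= sigma_algebra_id. Qed.

Lemma measurable_wrtP d' (T' : measurableType d') (f : T -> T') :
  measurable_wrt G f <-> measurable_fun setT (f : TG -> T').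
Proof.
split=> [mf _ B mB|mf B mB]; first by rewrite setTI; exact/measurable_TG/mf.
by apply/measurable_TG; rewrite -[X in measurable X]setTI; exact: mf.
Qed.

Lemma measurable_wrt_fun d' (T' : measurableType d') (f : T -> T') :
  measurable_wrt G f -> measurable_fun setT f.
Proof. by move=> mf _ B mB; rewrite setTI; exact/GM/mf. Qed.

(** Radon-Nikodym and the uniqueness of densities concern measures on a measurable type, so P is
    repackaged over [TG]. Both measures are the same set function, whence the equality for all A. *)
Lemma probability_restriction : exists Q : probability TG R, forall A, Q A = P A.
Proof.
pose q : set TG -> \bar R := P.
have q0 : q set0 = 0 by exact: measure0.
have qge A : 0 <= q A by exact: measure_ge0.
have qs : semi_sigma_additive q.
  move=> F mF tF mUF; apply: (@measure_semi_sigma_additive _ _ _ P) => //.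
  - by move=> i; exact/GM/measurable_TG.
  - exact/GM/measurable_TG.
have q1 : q setT = 1 by exact: probability_setT.
pose m1 := isMeasure.Build _ _ _ q q0 qge qs.
pose Q0 : {measure set TG -> \bar R} := HB.pack q m1.
pose m2 := Measure_isProbability.Build _ _ _ Q0 q1.
pose Q : probability TG R := HB.pack q m1 m2.
by exists Q.
Qed.

(** The identity from T to [TG] is measurable and pushes P forward to Q, so this is a change of
    variables. *)
Lemma integral_restriction (Q : probability TG R) : (forall A, Q A = P A) ->
  forall (f : T -> \bar R) A, G A -> measurable_wrt G f -> (forall w, 0 <= f w) ->
  \int[Q]_(w in A) f w = \int[P]_(w in A) f w.
Proof.
move=> QP f A GA mf f0.
have wide_band : measurable_fun setT (idfun : T -> TG).
  by move=> _ B mB; rewrite setTI; exact/GM/measurable_TG.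
rewrite -[RHS](@ge0_integral_pushforward _ _ T TG R idfun wide_band P A f)//.
- by apply: eq_measure_integral => B _ _; exact: QP.
- exact/measurable_TG.
- exact/measurable_funTS/measurable_wrtP.
Qed.

Lemma measurable_wrt_funepos (f : T -> \bar R) :
  measurable_wrt G f -> measurable_wrt G (f^\+).
Proof. by move=> /measurable_wrtP mf; exact/measurable_wrtP/measurable_funepos. Qed.

Lemma measurable_wrt_funeneg (f : T -> \bar R) :
  measurable_wrt G f -> measurable_wrt G (f^\-).
Proof. by move=> /measurable_wrtP mf; exact/measurable_wrtP/measurable_funeneg. Qed.

Lemma integral_restriction_signed (Q : probability TG R) :
  (forall A, Q A = P A) ->
  forall (f : T -> \bar R) A, G A -> measurable_wrt G f ->
  \int[Q]_(w in A) f w = \int[P]_(w in A) f w.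
Proof.
move=> QP f A GA mf; rewrite integralE [RHS]integralE; congr (_ - _).
  exact: (integral_restriction QP GA (measurable_wrt_funepos mf)).
exact: (integral_restriction QP GA (measurable_wrt_funeneg mf)).
Qed.

Lemma ae_restriction (Q : probability TG R) : (forall A, Q A = P A) ->
  forall p : set T, {ae Q, forall w, p w} -> {ae P, forall w, p w}.
Proof.
move=> QP p [N [mN N0 pN]]; exists N; split => //.
- exact/GM/measurable_TG.
- exact: (etrans (esym (QP N)) N0).
Qed.

(** Radon-Nikodym on [TG], for the finite measure sending A to E[X; A] against the restriction of
    P. *)
Lemma condexp_exists_integrable_ge0 (X : T -> \bar R) :
  P.-integrable setT X -> (forall w, 0 <= X w) ->
  exists Y, [/\ is_condexp P G X Y, forall w, 0 <= Y w & forall w, Y w \is a fin_num].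
Proof.
move=> iX X0; have [Q QP] := probability_restriction.
have mX := measurable_int _ iX.
pose nu : set TG -> \bar R := fun A => \int[P]_(w in A) X w.
have nu0 : nu set0 = 0 by rewrite /nu integral_set0.
have nuge A : 0 <= nu A by apply: integral_ge0.
have nus : semi_sigma_additive nu.
  move=> F mF tF mUF.
  apply: (@semi_sigma_additive_nng_induced _ _ _ P X) => //.
  - by move=> i; exact/GM/measurable_TG.
  - exact/GM/measurable_TG.
pose m1 := isMeasure.Build _ _ _ nu nu0 nuge nus.
pose nu1 : {measure set TG -> \bar R} := HB.pack nu m1.
have nufin : fin_num_fun nu.
  move=> A /measurable_TG/GM mA; apply: integrable_fin_num => //.
  exact: integrableS iX.
pose m2 := Measure_isFinite.Build _ _ _ nu1 nufin.
pose nu2 : {finite_measure set TG -> \bar R} := HB.pack nu m1 m2.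
have nuQ : nu2 `<< Q.
  apply/null_content_dominatesP => A mA QA0.
  apply: null_set_integral.
  - exact/GM/measurable_TG.
  - exact: measurable_funTS.
  - exact: (etrans (esym (QP A)) QA0).
have [Y [Y0 Yfin iY nuY]] := radon_nikodym_sigma_finite nuQ.
exists Y; split => //; split => //.
- by apply/measurable_wrtP; exact: measurable_int iY.
- move=> A GA; rewrite -(integral_restriction QP)// -?nuY//.
    exact/measurable_TG.
  by apply/measurable_wrtP; exact: measurable_int iY.
Qed.

(* X need not be integrable, and its integral need not even be sigma-finite on
   G, so Radon-Nikodym is applied to the slices X 1_{n <= X < n+1}. *)
Lemma condexp_exists_ge0 (X : T -> R) : measurable_fun setT X ->
  (forall w, (0 <= X w)%R) -> exists Y, is_condexp P G (EFin \o X) Y.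
Proof.
move=> mX X0.
pose D n := [set w | (n%:R <= X w < n.+1%:R)%R].
have mD n : measurable (D n).
  rewrite (_ : D n = setT `&` X @^-1` `[n%:R, n.+1%:R[); first exact: mX.
  by rewrite setTI; apply/seteqP; split => w /=; rewrite in_itv.
pose Xn n w := ((X w)%:E * (\1_(D n) w)%:E).
have mXn n : measurable_fun setT (Xn n).
  by apply/emeasurable_funM; apply/measurable_EFinP => //; exact: measurable_indic.
have Xn0 n w : 0 <= Xn n w by rewrite mule_ge0// lee_fin.
have Xnle n w : Xn n w <= n.+1%:R%:E.
  rewrite /Xn indicE; have [|_] := boolP (w \in D n); last by rewrite mule0 lee_fin.
  by rewrite inE /= => /andP[_ /ltW]; rewrite mule1 lee_fin.
have iXn n : P.-integrable setT (Xn n).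
  apply: (@le_integrable _ _ _ _ _ _ _ (cst n.+1%:R%:E)) => //.
    by move=> w _; rewrite gee0_abs//= (le_trans (Xnle n w))// lee_fin ler_norm.
  exact: finite_measure_integrable_cst.
have XE w : \sum_(n <oo) Xn n w = (X w)%:E.
  have truncX : ((Num.truncn (X w))%:R <= X w < (Num.truncn (X w)).+1%:R)%R.
    exact: truncn_itv.
  rewrite (@nneseriesD1 _ _ (Num.truncn (X w)))//.
  rewrite eseries0 ?adde0; last first.
    move=> n _ /eqP nt; rewrite /Xn indicE memNset ?mule0//= => nX.
    by apply: nt; symmetry; exact: truncn_def.
  by rewrite /Xn indicE mem_set ?mule1.
have /choice[Y Yn] n := condexp_exists_integrable_ge0 (iXn n) (Xn0 n).
exists (fun w => \sum_(n <oo) Y n w); split.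
- apply/measurable_wrtP/ge0_emeasurable_sum => [n w _ _|n _].
    by case: (Yn n).
  by apply/measurable_wrtP; case: (Yn n) => -[].
- by move=> _ w; apply: nneseries_ge0 => n _ _; case: (Yn n).
- move=> A GA; rewrite integral_nneseries//; [|exact: GM|..].
  + under eq_integral do rewrite /= -XE.
    rewrite integral_nneseries//; [|exact: GM|by move=> n; exact: measurable_funTS].
    by apply: eq_eseriesr => n _; case: (Yn n) => -[_ _ ->].
  + by move=> n; apply/measurable_funTS/measurable_wrt_fun; case: (Yn n) => -[].
  + by move=> n w _; case: (Yn n).
Qed.

Lemma condexp_exists_integrable (X : T -> R) :
  P.-integrable setT (EFin \o X) -> exists Y, is_condexp P G (EFin \o X) Y.
Proof.
move=> iX; have [X0|X0] := pselect (forall w, 0 <= (EFin \o X) w).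
  by have [Y []] := condexp_exists_integrable_ge0 iX X0; exists Y.
have [Y1 [[mY1 _ Y1E] Y10 Y1fin]] := condexp_exists_integrable_ge0
  (integrable_funepos measurableT iX) (funepos_ge0 _).
have [Y2 [[mY2 _ Y2E] Y20 Y2fin]] := condexp_exists_integrable_ge0
  (integrable_funeneg measurableT iX) (funeneg_ge0 _).
have int Y : measurable_wrt G Y -> (forall w, 0 <= Y w) ->
    \int[P]_w Y w \is a fin_num -> P.-integrable setT Y.
  move=> mY Y0 Yfin; apply/integrableP; split; first exact: measurable_wrt_fun.
  by under eq_integral do rewrite gee0_abs//; rewrite ltey_eq Yfin.
have GT : G setT by case: sG => G0 GC _; rewrite -(setD0 setT); exact: GC.
have iY1 : P.-integrable setT Y1.
  apply: int => //; rewrite Y1E//; apply: integrable_fin_num => //.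
  exact: integrable_funepos.
have iY2 : P.-integrable setT Y2.
  apply: int => //; rewrite Y2E//; apply: integrable_fin_num => //.
  exact: integrable_funeneg.
exists (Y1 \- Y2); split => //.
- by apply/measurable_wrtP/emeasurable_funB; exact/measurable_wrtP.
- move=> A GA; rewrite integralB; [|exact: GM|..].
  + by rewrite Y1E// Y2E// -integralE.
  + by apply: integrableS iY1 => //; exact: GM.
  + by apply: integrableS iY2 => //; exact: GM.
Qed.

Lemma condexp_unique_integrable (Y1 Y2 : T -> \bar R) :
  measurable_wrt G Y1 -> measurable_wrt G Y2 -> P.-integrable setT Y1 ->
  (forall A, G A -> \int[P]_(w in A) Y1 w = \int[P]_(w in A) Y2 w) ->
  {ae P, forall w, Y1 w = Y2 w}.
Proof.
move=> mY1 mY2 iY1 Y12; have [Q QP] := probability_restriction.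
have GT : G setT by case: sG => G0 GC _; rewrite -(setD0 setT); exact: GC.
apply: (ae_restriction QP).
have : ae_eq Q setT Y1 Y2.
  apply: integral_ae_eq => //.
  - apply/integrableP; split; first exact/measurable_wrtP.
    case/integrableP: iY1 => _; rewrite (integral_restriction QP)//.
    exact/measurable_wrtP/measurableT_comp/measurable_wrtP.
  - exact/measurable_wrtP.
  - move=> E _ /measurable_TG GE.
    by rewrite !(integral_restriction_signed QP)// Y12.
by apply: filterS => w /(_ I).
Qed.

Lemma sub_setI A B : G A -> G B -> G (A `&` B).
Proof. by move=> /measurable_TG GA /measurable_TG GB; exact/measurable_TG/measurableI. Qed.

(** Infinite integrals cannot be subtracted, so the integrable case is applied on the sets {Y <= n},
    which belong to G. Doing this for both functions covers every point where one of them is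
    finite. *)
Lemma condexp_unique_ge0 (Y1 Y2 : T -> \bar R) :
  measurable_wrt G Y1 -> measurable_wrt G Y2 ->
  (forall w, 0 <= Y1 w) -> (forall w, 0 <= Y2 w) ->
  (forall A, G A -> \int[P]_(w in A) Y1 w = \int[P]_(w in A) Y2 w) ->
  {ae P, forall w, Y1 w = Y2 w}.
Proof.
have half Y Z : measurable_wrt G Y -> measurable_wrt G Z ->
    (forall w, 0 <= Y w) -> (forall w, 0 <= Z w) ->
    (forall A, G A -> \int[P]_(w in A) Y w = \int[P]_(w in A) Z w) ->
    forall n, {ae P, forall w, Y w <= n%:R%:E -> Y w = Z w}.
  move=> mY mZ Y0 Z0 YZ n.
  pose D := [set w | Y w <= n%:R%:E].
  have GD : G D.
    rewrite (_ : D = Y @^-1` `]-oo, n%:R%:E]); first by apply: mY; exact: emeasurable_itv.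
    by apply/seteqP; split => w /=; rewrite in_itv.
  have mD : measurable_fun setT (fun w : TG => (\1_D w)%:E : \bar R).
    by apply/measurable_EFinP/measurable_indic; exact/measurable_TG.
  have : {ae P, forall w, Y w * (\1_D w)%:E = Z w * (\1_D w)%:E}.
    apply: condexp_unique_integrable.
    - by apply/measurable_wrtP/emeasurable_funM => //; exact/measurable_wrtP.
    - by apply/measurable_wrtP/emeasurable_funM => //; exact/measurable_wrtP.
    - apply: (@le_integrable _ _ _ _ _ _ _ (cst n%:R%:E)) => //.
      + apply/measurable_wrt_fun/measurable_wrtP/emeasurable_funM => //.
        exact/measurable_wrtP.
      + move=> w _; rewrite gee0_abs; last by rewrite mule_ge0// lee_fin.
        rewrite gee0_abs ?lee_fin//= indicE.
        have [|_] := boolP (w \in D); last by rewrite mule0 lee_fin.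
        by rewrite inE mule1.
      + exact: finite_measure_integrable_cst.
    - move=> A GA; rewrite -!integral_indic_mul//; apply: YZ; exact: sub_setI.
  apply: filterS => w + Yn.
  by rewrite indicE mem_set// !mule1.
move=> mY1 mY2 Y10 Y20 Y12.
have := ae_foralln (half _ _ mY1 mY2 Y10 Y20 Y12).
have := ae_foralln (half _ _ mY2 mY1 Y20 Y10 (fun A GA => esym (Y12 A GA))).
apply: filterS2 => w h2 h1.
have fin (y : \bar R) : 0 <= y -> y != +oo -> exists n, y <= n%:R%:E.
  case: y => // r _ _; exists (Num.truncn `|r|).+1.
  by rewrite lee_fin (le_trans (ler_norm _))// ltW// truncnS_gt.
have [y1|y1] := eqVneq (Y1 w) +oo; last first.
  by have [n /h1] := fin _ (Y10 w) y1.
have [y2|y2] := eqVneq (Y2 w) +oo; first by rewrite y1 y2.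
by have [n /h2] := fin _ (Y20 w) y2.
Qed.

Import HBNNSimple.

(** Approximating phi by simple functions over [TG] rather than over T keeps their level sets in G,
    where the hypothesis applies; monotone convergence does the rest. *)
Lemma integral_mul_eq_ge0 (phi X Y : T -> R) :
  measurable_wrt G phi -> measurable_fun setT X -> measurable_fun setT Y ->
  (forall w, 0 <= phi w)%R -> (forall w, 0 <= X w)%R -> (forall w, 0 <= Y w)%R ->
  (forall A, G A -> \int[P]_(w in A) (X w)%:E = \int[P]_(w in A) (Y w)%:E) ->
  \int[P]_w (phi w * X w)%:E = \int[P]_w (phi w * Y w)%:E.
Proof.
move=> mphi mX mY phi0 X0 Y0 XY.
have mphiG : measurable_fun setT (EFin \o phi : TG -> \bar R).
  by apply/measurable_EFinP/measurable_wrtP.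
pose h := nnsfun_approx measurableT mphiG.
have mh n : measurable_fun setT (h n : T -> R).
  by apply/measurable_wrt_fun/measurable_wrtP.
have limE (Z : T -> R) : measurable_fun setT Z -> (forall w, 0 <= Z w)%R ->
    \int[P]_w (phi w * Z w)%:E = limn (fun n => \int[P]_w (h n w * Z w)%:E).
  move=> mZ Z0; have ZE w : (phi w * Z w)%:E = limn (fun n => (h n w * Z w)%:E).
    apply/esym/cvg_lim => //; under eq_fun do rewrite EFinM.
    rewrite EFinM; apply: cvgeZr => //.
    by apply: (@cvg_nnsfun_approx _ TG R setT measurableT _ mphiG) => // t _; rewrite lee_fin.
  under eq_integral do rewrite ZE.
  apply: monotone_convergence => //.
  - by move=> n; apply/measurable_EFinP/measurable_funM.
  - by move=> n w _; rewrite lee_fin mulr_ge0.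
  - move=> w _ a b ab; rewrite lee_fin ler_wpM2r//.
    by have /lefP/(_ w) := @nd_nnsfun_approx _ TG R setT measurableT _ mphiG a b ab.
rewrite !limE//; congr (limn _); apply/funext => n.
have sumE (Z : T -> R) : measurable_fun setT Z -> (forall w, 0 <= Z w)%R ->
    \int[P]_w (h n w * Z w)%:E =
    \sum_(r \in range (h n)) r%:E * \int[P]_(w in h n @^-1` [set r]) (Z w)%:E.
  move=> mZ Z0.
  have m1 r : measurable_fun setT (\1_(h n @^-1` [set r]) : T -> R).
    apply: measurable_indic; exact/GM/measurable_TG.
  have r0 r w : (0 <= r * \1_(h n @^-1` [set r]) w)%R.
    by have := @nnfun_muleindic_ge0 _ _ _ (h n) r w; rewrite -EFinM lee_fin.
  under eq_integral do rewrite (fimfunE (h n)) mulr_fsuml -fsumEFin//.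
  rewrite ge0_integral_fsum//; last 2 first.
  - by move=> r; apply/measurable_EFinP/measurable_funM => //; exact: measurable_funM.
  - by move=> r w _; rewrite lee_fin mulr_ge0.
  apply: eq_fsbigr => r /set_mem[w _ <-].
  under eq_integral do rewrite -mulrA EFinM mulrC EFinM.
  rewrite ge0_integralZl_EFin//.
  - by rewrite -integral_indic_mul setTI.
  - by move=> x _; rewrite -EFinM lee_fin mulr_ge0.
  - by apply/emeasurable_funM; exact/measurable_EFinP.
rewrite !sumE//; apply: eq_fsbigr => r _; congr (_ * _); apply: XY.
exact/measurable_TG.
Qed.

(** Replacing b by - b gives the companion formula for the negative part of a product. *)
Lemma maxrM0 (a b : R) : (Num.max (a * b) 0 =
  Num.max a 0 * Num.max b 0 + Num.max (- a) 0 * Num.max (- b) 0)%R.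
Proof.
have maxp (x : R) : (0 <= x)%R -> Num.max x 0%R = x by move/max_idPl.
have maxn (x : R) : (x <= 0)%R -> Num.max x 0%R = 0%R by move/max_idPr.
case/orP: (le_total a 0%R) => a0; case/orP: (le_total b 0%R) => b0.
- rewrite (maxp (a * b)%R) ?mulr_le0// (maxn a)// (maxp (- a)%R) ?oppr_ge0//.
  by rewrite (maxp (- b)%R) ?oppr_ge0// mul0r add0r mulrNN.
- rewrite (maxn (a * b)%R) ?mulr_le0_ge0// (maxn a)// (maxn (- b)%R) ?oppr_le0//.
  by rewrite mul0r mulr0 addr0.
- rewrite (maxn (a * b)%R) ?mulr_ge0_le0// (maxn (- a)%R) ?oppr_le0// (maxn b)//.
  by rewrite mul0r mulr0 addr0.
- by rewrite (maxp (a * b)%R) ?mulr_ge0// (maxp a)// (maxp b)// (maxn (- a)%R) ?oppr_le0// mul0r addr0.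
Qed.

(** The parts X^+ and X^- have equal integrals over every set of G, so they may be exchanged against
    phi^+ and against phi^-. This exchange turns the positive part of the product phi X into its
    negative part. *)
Lemma integral_mul_eq0 (phi X : T -> R) :
  measurable_wrt G phi -> measurable_fun setT X ->
  P.-integrable setT (fun w => (phi w * X w)%:E) ->
  (forall A, G A -> \int[P]_(w in A) (X w)%:E = 0) ->
  \int[P]_w (phi w * X w)%:E = 0.
Proof.
move=> mphi mX iphiX X0.
have mphip : measurable_wrt G phi^\+%R.
  by apply/measurable_wrtP/measurable_funrpos/measurable_wrtP.
have mphin : measurable_wrt G phi^\-%R.
  by apply/measurable_wrtP/measurable_funrneg/measurable_wrtP.
have mXp := measurable_funrpos mX.
have mXn := measurable_funrneg mX.
have XE A : G A ->
    \int[P]_(w in A) (X^\+%R w)%:E = \int[P]_(w in A) (X^\-%R w)%:E.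
  move=> GA; have := X0 _ GA; rewrite integralE funerpos funerneg.
  have := @integral_ge0 _ _ _ P A (EFin \o X^\-%R) (fun w _ => funrneg_ge0 X w).
  have := @integral_ge0 _ _ _ P A (EFin \o X^\+%R) (fun w _ => funrpos_ge0 X w).
  (* Since oo - oo is -oo, a difference equal to 0 forces both integrals to be finite. *)
  rewrite /comp; case: integral => [x| |]//; case: integral => [y| |]// _ _.
  by move=> /eqP; rewrite -EFinB eqe subr_eq0 => /eqP ->.
have Ep := integral_mul_eq_ge0 mphip mXp mXn (funrpos_ge0 _) (funrpos_ge0 _) (funrneg_ge0 _) XE.
have En := integral_mul_eq_ge0 mphin mXp mXn (funrneg_ge0 _) (funrpos_ge0 _) (funrneg_ge0 _) XE.
have m4 (f g : T -> R) : measurable_fun setT f -> measurable_fun setT g ->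
    measurable_fun setT (fun w => (f w * g w)%:E : \bar R).
  by move=> mf mg; apply/measurable_EFinP/measurable_funM.
have posE : (fun w => (phi w * X w)%:E)^\+ =
    (fun w => (phi^\+%R w * X^\+%R w)%:E + (phi^\-%R w * X^\-%R w)%:E).
  by apply/funext => w; rewrite funeposE -EFinD -EFin_max maxrM0.
have negE : (fun w => (phi w * X w)%:E)^\- =
    (fun w => (phi^\+%R w * X^\-%R w)%:E + (phi^\-%R w * X^\+%R w)%:E).
  apply/funext => w; rewrite funenegE -EFinD -EFinN -EFin_max -mulrN.
  by rewrite maxrM0 opprK.
have mphip' := measurable_wrt_fun mphip.
have mphin' := measurable_wrt_fun mphin.
have posnegE : \int[P]_w (fun w => (phi w * X w)%:E)^\+ w =
    \int[P]_w (fun w => (phi w * X w)%:E)^\- w.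
  rewrite posE negE.
  rewrite !ge0_integralD//; do ?by [apply: m4 | move=> w _; rewrite lee_fin mulr_ge0].
  by rewrite Ep En.
rewrite integralE posnegE subee//.
by apply: integrable_fin_num => //; exact: integrable_funeneg.
Qed.

Lemma condexp_ge0P (X : T -> R) : measurable_fun setT X ->
  (forall w, 0 <= X w)%R -> is_condexp P G (EFin \o X) (condexp P G (EFin \o X)).
Proof. by move=> mX /(condexp_exists_ge0 mX) exY; rewrite /condexp; exact: xgetPex. Qed.

Lemma condexp_integrableP (X : T -> R) : P.-integrable setT (EFin \o X) ->
  is_condexp P G (EFin \o X) (condexp P G (EFin \o X)).
Proof. by move=> /condexp_exists_integrable exY; rewrite /condexp; exact: xgetPex. Qed.

(* condexp picks a version from the set of all versions, which depends on the
   function only up to null sets; hence an equality everywhere. *)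
Lemma eq_ae_condexp (X Y : T -> R) : measurable_fun setT X -> measurable_fun setT Y ->
  (forall w, 0 <= X w)%R -> (forall w, 0 <= Y w)%R ->
  {ae P, forall w, X w = Y w} ->
  condexp P G (EFin \o X) = condexp P G (EFin \o Y).
Proof.
move=> mX mY X0 Y0 XY; congr (xget _ _); apply/seteqP.
have intE A : G A ->
    \int[P]_(w in A) (EFin \o X) w = \int[P]_(w in A) (EFin \o Y) w.
  move=> GA; apply: ge0_ae_eq_integral.
  - exact: GM.
  - exact/measurable_funTS/measurable_EFinP.
  - exact/measurable_funTS/measurable_EFinP.
  - by move=> w _; rewrite lee_fin.
  - by move=> w _; rewrite lee_fin.
  - by apply: filterS XY => w /= -> _.
split=> Z [mZ Z0 ZE]; split => //= [_|A GA].
- by apply: Z0 => w; rewrite /= lee_fin.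
- by rewrite ZE// intE.
- by apply: Z0 => w; rewrite /= lee_fin.
- by rewrite ZE// intE.
Qed.

(** Taking out what is known. X need not be integrable, so the two sides are compared by the
    uniqueness of nonnegative versions. *)
Lemma condexp_indicM (X : T -> R) (B : set T) (c : R) : measurable_fun setT X ->
  (forall w, 0 <= X w)%R -> G B -> (0 <= c)%R ->
  {ae P, forall w, condexp P G (fun w => (c * (\1_B w * X w))%:E) w =
    c%:E * ((\1_B w)%:E * condexp P G (EFin \o X) w)}.
Proof.
move=> mX X0 GB c0.
have mB : measurable_wrt G (\1_B : T -> R).
  by apply/measurable_wrtP/measurable_indic/measurable_TG.
have mBX : measurable_fun setT (fun w => \1_B w * X w)%R.
  by apply: measurable_funM => //; exact: measurable_wrt_fun.
have BX0 w : (0 <= \1_B w * X w)%R by rewrite mulr_ge0.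
have [] := @condexp_ge0P (fun w => c * (\1_B w * X w))%R; first exact: measurable_funM.
  by move=> w; rewrite mulr_ge0.
have [mZ Z0 ZE] := condexp_ge0P mX X0.
set Y := condexp P G _ => mY Y0 YE; set Z := condexp P G _ in mZ Z0 ZE *.
have {}Z0 w : 0 <= Z w by apply: Z0 => x; rewrite /= lee_fin.
have mBZ : measurable_wrt G (fun w => (\1_B w)%:E * Z w).
  apply/measurable_wrtP/emeasurable_funM; last exact/measurable_wrtP.
  exact/measurable_EFinP/measurable_wrtP.
apply: condexp_unique_ge0 => //.
- apply/measurable_wrtP/emeasurable_funM; last exact/measurable_wrtP.
  exact: measurable_cst.
- by apply: Y0 => w; rewrite /= lee_fin mulr_ge0.
- by move=> w; rewrite !mule_ge0// lee_fin.
- move=> A GA; rewrite YE//.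
  rewrite [RHS](ge0_integralZl P (GM GA)); first last.
  + by rewrite lee_fin.
  + by move=> w _; rewrite mule_ge0// lee_fin.
  + exact/measurable_funTS/measurable_wrt_fun.
  under [X in _ = _ * X]eq_integral do rewrite muleC.
  rewrite -integral_indic_mul ZE; last exact: sub_setI.
  under eq_integral do rewrite /= EFinM.
  rewrite (ge0_integralZl P (GM GA)); first last.
  + by rewrite lee_fin.
  + by move=> w _; rewrite lee_fin.
  + exact/measurable_funTS/measurable_EFinP.
  congr (_ * _); rewrite integral_indic_mul.
  by apply: eq_integral => w _; rewrite /= EFinM muleC.
Qed.

Lemma measurable_wrt_condexpR (X : T -> R) : P.-integrable setT (EFin \o X) ->
  measurable_wrt G (condexpR P G X).
Proof.
move=> /condexp_integrableP[mY _ _]; apply/measurable_wrtP/measurableT_comp => //.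
exact/measurable_wrtP.
Qed.

Lemma condexpR_unique (X h : T -> R) : P.-integrable setT (EFin \o X) ->
  P.-integrable setT (EFin \o h) -> measurable_wrt G h ->
  (forall A, G A -> \int[P]_(w in A) (h w)%:E = \int[P]_(w in A) (X w)%:E) ->
  {ae P, forall w, condexpR P G X w = h w}.
Proof.
move=> iX ih mh hX; have [mY _ YE] := condexp_integrableP iX.
have mh' : measurable_wrt G (EFin \o h).
  by apply/measurable_wrtP/measurable_EFinP/measurable_wrtP.
have := @condexp_unique_integrable (EFin \o h) _ mh' mY ih.
move=> /(_ _)/filterS; apply => [w e|A GA]; first by rewrite /condexpR/= -e.
by rewrite YE// -hX.
Qed.

Lemma sub_sigma_setT : G setT.
Proof. exact/measurable_TG. Qed.

Lemma condexp_fin_num (X : T -> R) : P.-integrable setT (EFin \o X) ->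
  {ae P, forall w, condexp P G (EFin \o X) w = (condexpR P G X w)%:E} /\
  P.-integrable setT (condexp P G (EFin \o X)).
Proof.
move=> iX; have [mY _ YE] := condexp_integrableP iX.
have iY : P.-integrable setT (condexp P G (EFin \o X)).
  apply/integrableP; split; first exact: measurable_wrt_fun.
  apply/abse_integralP => //; first exact: measurable_wrt_fun.
  rewrite YE; last exact: sub_sigma_setT.
  by rewrite -fin_num_abs; exact: integrable_fin_num.
split=> //; have := integrable_ae measurableT iY.
by apply: filterS => w /(_ I) fin; rewrite /condexpR/= fineK.
Qed.

Lemma integral_condexpR (X : T -> R) (A : set T) : P.-integrable setT (EFin \o X) ->
  G A -> \int[P]_(w in A) (condexpR P G X w)%:E = \int[P]_(w in A) (X w)%:E.
Proof.
move=> iX GA; have [mY _ YE] := condexp_integrableP iX.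
have [YR _] := condexp_fin_num iX.
transitivity (\int[P]_(w in A) condexp P G (EFin \o X) w); last exact: YE.
apply: ae_eq_integral.
- exact: GM.
- apply/measurable_funTS/measurable_EFinP/measurable_wrt_fun.
  exact: measurable_wrt_condexpR.
- exact/measurable_funTS/measurable_wrt_fun.
- by apply: filterS YR => w -> _.
Qed.

End sub_sigma_algebra.

(** * The variable exponent norm *)

Lemma probability_ae_ex d (T : measurableType d) (R : realType)
    (P : probability T R) (A : T -> Prop) :
  {ae P, forall w, A w} -> exists w, A w.
Proof.
move=> [N [mN N0 AN]]; apply: contrapT => nA.
have NT : N = setT.
  by apply/seteqP; split => // w _; apply: AN => Aw; apply: nA; exists w.
by have := probability_setT P; rewrite -NT [P N]N0 => /eqP; rewrite eq_sym onee_eq0.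
Qed.

Lemma sum_int_fsbig (R : realType) (u : int -> \bar R) (n j : nat) :
  (\sum_(i < n) u (i%:Z - j%:Z)%R =
   \sum_(k \in [set` [seq (i%:Z - j%:Z)%R | i <- iota 0 n]]) u k)%E.
Proof.
rewrite -fsbig_seq; last first.
  by rewrite map_inj_uniq ?iota_uniq// => a b /addIr[].
by rewrite big_map -/(index_iota 0 n) -[in RHS](subn0 n) big_mkord.
Qed.

(** Every finite set of integers lies in some window from - j to j, so bounds on windows control the
    unordered sum. *)
Lemma esum_int_le (R : realType) (u : int -> \bar R) (M : \bar R) :
  (forall k, 0 <= u k)%E ->
  (forall n j : nat, \sum_(i < n) u (i%:Z - j%:Z)%R <= M)%E ->
  (\esum_(k in [set: int]) u k <= M)%E.
Proof.
move=> u0 uM; apply: ge_ereal_sup => _ [X [/finite_seqP[r XE] _] <-].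
pose j := \max_(k <- r) `|k|%N.
have rj k : k \in r -> (`|k| <= j)%N.
  by move=> kr; rewrite /j (big_rem k)//= leq_maxl.
apply: le_trans (uM (j + j).+1 j); rewrite sum_int_fsbig.
apply: lee_fsum_nneg_subset => //=.
- by rewrite XE; exact: finite_seq.
- rewrite XE => k /set_mem/= kr; apply/mem_set.
  change (is_true (k \in [seq (i%:Z - j%:Z)%R | i <- iota 0 (j + j).+1])).
  apply/mapP.
  have := rj _ kr; move=> kj; exists `|(k + j%:Z)%R|%N; last first.
    rewrite gez0_abs; first by rewrite addrK.
    lia.
  rewrite mem_iota; lia.
Qed.

Lemma le_esum_int (R : realType) (u : int -> \bar R) (n j : nat) :
  (\sum_(i < n) u (i%:Z - j%:Z)%R <= \esum_(k in [set: int]) u k)%E.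
Proof.
rewrite sum_int_fsbig; apply: ereal_sup_ubound => /=.
by eexists; [|reflexivity]; split => //; exact: finite_seq.
Qed.

Section exponent.
Context d (T : measurableType d) (R : realType) (P : probability T R).
Context (p : T -> R) (pexp : is_exponent P p).
Local Open Scope ereal_scope.
Local Notation pm := (pminus P p).
Local Notation pp := (pplus P p).

(** Some point satisfies both essential bounds, so the infimum is at most the supremum, and the
    one-sided bounds in [is_exponent] then make both finite. *)
Lemma exponent_fin : ess_inf P (EFin \o p) = pm%:E /\ ess_sup P (EFin \o p) = pp%:E.
Proof.
case: pexp => mp p0 pi ps; have P1 : 0 < P setT by rewrite probability_setT.
have ip : ess_inf P (EFin \o p) <= ess_sup P (EFin \o p).
  have /probability_ae_ex[w [h1 h2]] : {ae P, forall w,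
      ess_inf P (EFin \o p) <= (p w)%:E /\ (p w)%:E <= ess_sup P (EFin \o p)}.
    apply: filterS2 (ess_inf_le P (EFin \o p)) (ess_sup_ge P (EFin \o p)) => w a b.
    by split.
  exact: le_trans h1 h2.
split; rewrite /pminus /pplus fineK// fin_numElt.
  by rewrite (lt_trans _ pi)//= (le_lt_trans ip ps).
by rewrite ps andbT (lt_le_trans _ ip)// (lt_trans _ pi).
Qed.

Lemma exponent_ae : {ae P, forall w, (pm <= p w <= pp)%R}.
Proof.
have [pmE ppE] := exponent_fin.
apply: filterS2 (ess_inf_le P (EFin \o p)) (ess_sup_ge P (EFin \o p)) => w.
by rewrite pmE ppE !lee_fin => -> ->.
Qed.

Lemma pminus_gt0 : (0 < pm)%R.
Proof. by have [pmE _] := exponent_fin; case: pexp => _ _; rewrite pmE lte_fin. Qed.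

Lemma pminus_le_pplus : (pm <= pp)%R.
Proof.
have /probability_ae_ex[w /andP[h1 h2]] := exponent_ae; exact: le_trans h1 h2.
Qed.

Lemma pplus_gt0 : (0 < pp)%R.
Proof. exact: lt_le_trans pminus_gt0 pminus_le_pplus. Qed.

Lemma exponent_gt0 w : (0 < p w)%R. Proof. by case: pexp. Qed.

Lemma exponent_neq0 w : p w != 0%R. Proof. by rewrite gt_eqF// exponent_gt0. Qed.

Lemma measurable_exponent : measurable_fun setT p. Proof. by case: pexp. Qed.

Lemma measurable_fun_powR_exponent (u : T -> R) : measurable_fun setT u ->
  measurable_fun setT (fun w => u w `^ p w)%R.
Proof.
move=> mu; rewrite /powR.
apply: measurable_fun_ifT.
- exact: measurable_fun_eqr.
- under eq_fun do rewrite (negbTE (exponent_neq0 _)).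
  exact: measurable_cst.
- apply/measurableT_comp => //; apply/measurable_funM => //.
    exact: measurable_exponent.
  by apply/measurableT_comp.
Qed.

Lemma measurable_fun_modular (u : T -> \bar R) : measurable_fun setT u ->
  measurable_fun setT (fun w => `|u w| `^ p w).
Proof.
move=> mu.
have -> : (fun w => `|u w| `^ p w) = (fun w => if `|u w| == +oo then +oo
    else ((fine `|u w|) `^ p w)%:E).
  apply/funext => w; case: (u w) => [r| |] //=; by rewrite (negbTE (exponent_neq0 w)).
apply: measurable_fun_ifT.
- apply: measurable_fun_eqe => //; exact: measurableT_comp.
- exact: measurable_cst.
- apply/measurable_EFinP/measurable_fun_powR_exponent.
  by apply/measurableT_comp => //; apply/measurableT_comp.
Qed.

Lemma le_modular (x y : \bar R) w : `|x| <= `|y| -> `|x| `^ p w <= `|y| `^ p w.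
Proof.
move=> xy; apply: gt0_ler_poweR => //; rewrite ?in_itv/= ?abse_ge0 ?leey//.
exact/ltW/exponent_gt0.
Qed.

Lemma le_rho (u v : T -> \bar R) : measurable_fun setT u -> measurable_fun setT v ->
  {ae P, forall w, `|u w| <= `|v w|} -> rho P p u <= rho P p v.
Proof.
move=> mu mv uv; apply: ae_ge0_le_integral => //.
- by move=> w _; exact: poweR_ge0.
- exact: measurable_fun_modular.
- by move=> w _; exact: poweR_ge0.
- exact: measurable_fun_modular.
- by apply: filterS uv => w uvw _; exact: le_modular.
Qed.

Lemma vnorm_ge0 (u : T -> \bar R) : 0 <= vnorm P p u.
Proof. by apply: le_ereal_inf_tmp => _ [g [/ltW g0 _] <-]; rewrite lee_fin. Qed.

Lemma vnorm_le (u : T -> \bar R) (g : R) : (0 < g)%R ->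
  rho P p (fun w => u w * (g^-1)%:E) <= 1 -> vnorm P p u <= g%:E.
Proof. by move=> g0 ug; apply: ereal_inf_lbound; exists g. Qed.

(** The modular of u / g decreases in g, so the admissible scales are upward closed. Nothing is
    claimed at the norm itself; later arguments pay for this with a factor such as 2 or 1 + e. *)
Lemma vnorm_lt (u : T -> \bar R) (g : R) : measurable_fun setT u ->
  vnorm P p u < g%:E -> (0 < g)%R /\ rho P p (fun w => u w * (g^-1)%:E) <= 1.
Proof.
move=> mu /ereal_inf_lt[_ [h [h0 uh] <-]]; rewrite lte_fin => hg.
have g0 := lt_trans h0 hg; split => //; apply: le_trans uh.
have mg (c : R) : measurable_fun setT (fun w => u w * c%:E).
  by apply/emeasurable_funM => //; exact: measurable_cst.
apply: le_rho => //; apply/nearW => w.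
rewrite !abseM lee_wpmul2l ?abse_ge0//= lee_fin !ger0_norm ?invr_ge0 ?(ltW h0) ?(ltW g0)//.
by rewrite lef_pV2 ?posrE// ltW.
Qed.

Lemma vnorm_lty_ae (u : T -> \bar R) : measurable_fun setT u ->
  vnorm P p u < +oo -> {ae P, forall w, `|u w| < +oo}.
Proof.
move=> mu uoo.
have [g ug] : exists g : R, vnorm P p u < g%:E.
  exists (fine (vnorm P p u) + 1)%R; rewrite EFinD fineK.
    by rewrite lteDl// ?ge0_fin_numE ?vnorm_ge0// lte_fin.
  by rewrite ge0_fin_numE ?vnorm_ge0.
have [g0 rg] := vnorm_lt mu ug.
have mg : measurable_fun setT (fun w => u w * (g^-1)%:E).
  by apply/emeasurable_funM => //; exact: measurable_cst.
have ig : P.-integrable setT (fun w => `|u w * (g^-1)%:E| `^ p w).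
  apply/integrableP; split; first exact: measurable_fun_modular.
  by under eq_integral do rewrite gee0_abs ?poweR_ge0//; rewrite (le_lt_trans rg)// ltry.
have := integrable_ae measurableT ig; apply: filterS => w /(_ I).
rewrite ltey; apply: contraTneq => uy.
rewrite abseM uy gt0_mulye ?poweRyr ?exponent_neq0//.
by rewrite abse_EFin lte_fin ger0_norm ?invr_gt0 ?invr_ge0// ltW.
Qed.

Lemma rho_indicM (A : set T) (c : R) : measurable A -> (0 <= c)%R ->
  rho P p (fun w => (\1_A w)%:E * c%:E) = \int[P]_(w in A) (c `^ p w)%:E.
Proof.
move=> mA c0; rewrite [RHS]integral_mkcond; apply: eq_integral => w _.
rewrite patchE indicE; case: ifPn => _; rewrite ?mul1e ?mul0e ?abse0 ?poweR0r ?exponent_neq0//.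
by rewrite gee0_abs ?lee_fin.
Qed.

Lemma vnorm_indic_le1 (A : set T) : measurable A -> vnorm P p (EFin \o \1_A) <= 1.
Proof.
move=> mA; apply: vnorm_le => //; rewrite invr1 rho_indicM//.
under eq_integral do rewrite powR1.
by rewrite integral_cst// mul1e probability_le1.
Qed.

Lemma measurable_powRc (A : set T) (c : R) : measurable_fun A (fun w => (c `^ p w)%:E).
Proof.
apply/measurable_funTS/measurable_EFinP/measurable_fun_powR_exponent.
exact: measurable_cst.
Qed.

Lemma vnorm_indic_eq0 (A : set T) : measurable A ->
  vnorm P p (EFin \o \1_A) = 0 -> P A = 0.
Proof.
move=> mA A0; apply/eqP; rewrite eq_le measure_ge0 andbT leNgt; apply/negP => PA0.
have PAfin : P A \is a fin_num by exact: fin_num_measure.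
set a := fine (P A); have PAE : P A = a%:E by rewrite fineK.
have a0 : (0 < a)%R by rewrite -lte_fin -PAE.
have a1 : (a <= 1)%R by rewrite -lee_fin -PAE probability_le1.
(* As g <= 1 and p >= p^-, the power g^(- p) is at least g^(- p^-) = 2 / a, so the modular of the
   indicator at scale g is at least 2. *)
pose g := ((a / 2) `^ pm^-1)%R.
have a20 : (0 < a / 2)%R by rewrite divr_gt0.
have g0 : (0 < g)%R by rewrite powR_gt0.
have mi : measurable_fun setT (EFin \o \1_A : T -> \bar R).
  exact/measurable_EFinP/measurable_indic.
have [_] : (0 < g)%R /\ rho P p (fun w => (\1_A w)%:E * (g^-1)%:E) <= 1.
  by apply: vnorm_lt => //; rewrite A0 lte_fin.
rewrite rho_indicM ?invr_ge0 ?(ltW g0)//; apply/negP; rewrite -ltNge.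
have lb : {ae P, forall w, A w -> (2 / a)%:E <= (g^-1 `^ p w)%:E}.
  apply: filterS exponent_ae => w /andP[pw _] _; rewrite lee_fin.
  have -> : (2 / a = g^-1 `^ pm)%R.
    rewrite /g -powRN -powRrM mulNr mulVf ?gt_eqF ?pminus_gt0//.
    by rewrite powR_inv1 ?ltW// invf_div.
  apply: ler_powR => //; rewrite invf_ge1//.
  rewrite -[leRHS](congr1 (fun f => f pm^-1%R) (@powR1 R)) ge0_ler_powR ?nnegrE ?invr_ge0 ?ltW ?pminus_gt0//.
  lra.
apply: (@lt_le_trans _ _ (\int[P]_(w in A) (2 / a)%:E)).
  rewrite integral_cst// [X in _ * X]PAE -EFinM lte_fin divfK ?gt_eqF//.
  by rewrite ltr1n.
apply: ae_ge0_le_integral => //.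
- by move=> w _; rewrite lee_fin divr_ge0// ltW.
- by move=> w _; rewrite lee_fin powR_ge0.
- exact: measurable_powRc.
Qed.

(* When the norm is 0 its real inverse is 0 too, and the claim is about a u
   that vanishes almost everywhere. *)
Lemma vnorm_indic_normalized (A : set T) (u : T -> \bar R) :
  measurable A -> measurable_fun setT u ->
  {ae P, forall w, `|u w| <= ((fine (vnorm P p (EFin \o \1_A)))^-1 * \1_A w)%:E} ->
  vnorm P p u <= 1.
Proof.
move=> mA mu uA; have mI : measurable_fun setT (EFin \o \1_A : T -> \bar R).
  exact/measurable_EFinP/measurable_indic.
have NE : vnorm P p (EFin \o \1_A) = (fine (vnorm P p (EFin \o \1_A)))%:E.
  rewrite fineK// ge0_fin_numE ?vnorm_ge0//.
  exact: le_lt_trans (vnorm_indic_le1 mA) (ltry _).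
have : (0 <= fine (vnorm P p (EFin \o \1_A)))%R by exact/fine_ge0/vnorm_ge0.
set N := fine _ in NE uA *; move=> N0.
have mM (v : T -> \bar R) (c : R):
    measurable_fun setT v -> measurable_fun setT (fun w => v w * c%:E).
  by move=> mv; apply/emeasurable_funM => //; exact: measurable_cst.
apply/lee_addgt0Pr => e e0; rewrite -EFinD.
have g1 : (1 < 1 + e)%R by rewrite ltrDl.
have g0 : (0 < 1 + e)%R by rewrite (lt_trans ltr01).
apply: vnorm_le => //.
have [h [h0 Nh hN]] : exists h : R, [/\ (0 < h)%R, (N < h)%R & (N^-1 * (1 + e)^-1 <= h^-1)%R].
  have [->|N_neq0] := eqVneq N 0%R; first by exists 1%R; rewrite invr0 mul0r invr1.
  have N_gt0 : (0 < N)%R by rewrite lt_neqAle eq_sym N_neq0.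
  by exists (N * (1 + e))%R; rewrite mulr_gt0 ?ltr_pMr// invfM.
have [_] : (0 < h)%R /\ rho P p (fun w => (\1_A w)%:E * (h^-1)%:E) <= 1.
  by apply: vnorm_lt => //; rewrite NE lte_fin.
apply: le_trans; apply: le_rho; [exact: mM|exact: mM|].
apply: filterS uA => w uAw; rewrite !abseM.
apply: (@le_trans _ _ ((N^-1 * \1_A w)%:E * `|((1 + e)^-1)%:E|)).
  by rewrite lee_wpmul2r ?abse_ge0.
rewrite !abse_EFin -!EFinM lee_fin !ger0_norm ?invr_ge0 ?(ltW g0) ?(ltW h0)//.
by rewrite mulrAC mulrC ler_wpM2l.
Qed.

(** * Dyadic level sets and two-sided bounds for the norm *)

Section level_sets.
Context (s : T -> \bar R) (ms : measurable_fun setT s) (s0 : forall w, 0 <= s w).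

Definition level (k : int) : set T := [set w | ((2 : R) ^ k)%:E < s w].

(** With this normalisation 2^(k+1) / theta_k is the inverse norm of the indicator of the level set,
    which is the bound required of an atom. *)
Definition level_coef (k : int) : R :=
  (2 * 2 ^ k * fine (vnorm P p (EFin \o \1_(level k))))%R.

Lemma exp2z_gt0 (k : int) : (0 < (2 : R) ^ k)%R.
Proof. exact: exprz_gt0. Qed.

Lemma measurable_level k : measurable (level k).
Proof. by rewrite -[level k]setTI; exact: emeasurable_fun_o_infty. Qed.

Lemma level_norm_fin k :
  vnorm P p (EFin \o \1_(level k)) = (fine (vnorm P p (EFin \o \1_(level k))))%:E.
Proof.
rewrite fineK// ge0_fin_numE ?vnorm_ge0//.
exact: le_lt_trans (vnorm_indic_le1 (measurable_level k)) (ltry _).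
Qed.

Lemma level_norm_ge0 k : (0 <= fine (vnorm P p (EFin \o \1_(level k))))%R.
Proof. exact/fine_ge0/vnorm_ge0. Qed.

Lemma level_coef_ge0 k : (0 <= level_coef k)%R.
Proof. by rewrite !mulr_ge0 ?level_norm_ge0// ltW ?exp2z_gt0. Qed.

Definition level_integral (lam : R) (k : int) : \bar R :=
  \int[P]_(w in level k) ((2 ^ k / lam) `^ p w)%:E.

Lemma level_integral_ge0 lam k : 0 <= level_integral lam k.
Proof. by apply: integral_ge0 => w _; rewrite lee_fin powR_ge0. Qed.

Lemma measurable_scale (c : R) : measurable_fun setT (fun w => s w * c%:E).
Proof. by apply/emeasurable_funM => //; exact: measurable_cst. Qed.

Lemma level_integral_le lam k : (0 < lam)%R ->
  level_integral lam k <= rho P p (fun w => s w * (lam^-1)%:E).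
Proof.
move=> lam0; rewrite /level_integral -rho_indicM; last 2 first.
- exact: measurable_level.
- by rewrite divr_ge0// ltW// exp2z_gt0.
apply: le_rho.
- apply/emeasurable_funM; last exact: measurable_cst.
  exact/measurable_EFinP/measurable_indic/measurable_level.
- exact: measurable_scale.
apply/nearW => w; rewrite indicE; case: (boolP (w \in level k)) => [/set_mem wk|_].
  rewrite mul1e EFinM !abseM lee_wpmul2r ?abse_ge0//.
  by rewrite gee0_abs ?lee_fin ?(ltW (exp2z_gt0 k))// gee0_abs// ltW.
by rewrite mul0e abse0 abse_ge0.
Qed.

(** Let I <= 1 be the level integral. At the scale g = I^(1/p^+) lam / 2^k the integrand becomes
    (2^k / lam)^p I^(- p/p^+), which is at most (2^k / lam)^p / I because p <= p^+. So the modular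
    of the indicator at scale g is at most 1. *)
Lemma level_norm_le lam k : (0 < lam)%R ->
  rho P p (fun w => s w * (lam^-1)%:E) <= 1 ->
  ((fine (vnorm P p (EFin \o \1_(level k))) * 2 ^ k / lam) `^ pp)%:E
    <= level_integral lam k.
Proof.
move=> lam0 rlam; set N := fine _.
have k0 := exp2z_gt0 k.
have I1 : level_integral lam k <= 1 := le_trans (level_integral_le k lam0) rlam.
have IE : level_integral lam k = (fine (level_integral lam k))%:E.
  by rewrite fineK// ge0_fin_numE ?level_integral_ge0// (le_lt_trans I1)// ltry.
set I := fine _ in IE; rewrite IE lee_fin.
have I0 : (0 <= I)%R by rewrite -lee_fin -IE level_integral_ge0.
have {}I1 : (I <= 1)%R by rewrite -lee_fin -IE.
have pp0 := pplus_gt0.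
(* J = I is the natural choice, but J^-1 is needed and I may be 0. *)
suff key J : (I <= J)%R -> (0 < J)%R -> (J <= 1)%R ->
    ((N * 2 ^ k / lam) `^ pp <= J)%R.
  have [I_eq0|I_neq0] := eqVneq I 0%R; last first.
    by apply: key => //; rewrite lt_neqAle eq_sym I_neq0.
  (* For I = 0 the claim [key] would bound t by every J in (0, 1], and J = min(1, t / 2) refutes t >
     0. *)
  rewrite I_eq0 leNgt; apply/negP => t0.
  set t := ((_ * _ / _) `^ _)%R in key t0.
  have : (t <= Num.min 1 (t / 2))%R.
    apply: key; last by rewrite ge_min lexx.
      by rewrite I_eq0 le_min ler01 divr_ge0// ltW.
    by rewrite lt_min ltr01 divr_gt0.
  by rewrite le_min => /andP[_]; rewrite leNgt ltr_pdivrMr// ltr_pMr// ltr1n.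
move=> IJ J0 J1.
pose g := (J `^ pp^-1 * lam / 2 ^ k)%R.
have g0 : (0 < g)%R by rewrite !mulr_gt0 ?powR_gt0 ?invr_gt0.
have : N%:E <= g%:E.
  rewrite /N -level_norm_fin; apply: vnorm_le => //.
  rewrite rho_indicM ?invr_ge0 ?(ltW g0)//; last exact: measurable_level.
  have gE : (g^-1 = (2 ^ k / lam) * J `^ (- pp^-1))%R.
    by rewrite /g powRN !invfM invrK; ring.
  apply: (@le_trans _ _ (\int[P]_(w in level k) ((J^-1)%:E * ((2 ^ k / lam) `^ p w)%:E))).
    apply: ae_ge0_le_integral.
    - exact: measurable_level.
    - by move=> w _; rewrite lee_fin powR_ge0.
    - exact: measurable_powRc.
    - by move=> w _; rewrite -EFinM lee_fin mulr_ge0 ?invr_ge0 ?powR_ge0 ?(ltW J0).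
    - apply/emeasurable_funM; [exact: measurable_cst|exact: measurable_powRc].
    apply: filterS exponent_ae => w /andP[_ ppw] _.
    rewrite gE -EFinM lee_fin powRM ?powR_ge0 ?divr_ge0 ?(ltW lam0) ?(ltW k0)//.
    rewrite mulrC ler_wpM2r ?powR_ge0// -powRrM -(powR_inv1 (ltW J0)).
    apply: ger_powR; first by rewrite J0.
    by rewrite mulNr lerN2 mulrC ler_pdivrMr// mul1r.
  rewrite (ge0_integralZl P (measurable_level k)); first last.
  - by rewrite lee_fin invr_ge0 ltW.
  - by move=> w _; rewrite lee_fin powR_ge0.
  - exact: measurable_powRc.
  by rewrite -/(level_integral lam k) IE -EFinM lee_fin mulrC ler_pdivrMr// mul1r.
rewrite lee_fin => Ng.
have -> : J = ((J `^ pp^-1) `^ pp)%R.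
  by rewrite -powRrM mulVf ?gt_eqF// powRr1// ltW.
apply: ge0_ler_powR; rewrite ?nnegrE ?powR_ge0 ?(ltW pp0)//.
  by rewrite divr_ge0 ?mulr_ge0 ?level_norm_ge0 ?(ltW k0) ?(ltW lam0).
by rewrite ler_pdivrMr// -ler_pdivlMr.
Qed.

(** The minimum is what makes the induction go through: the terms that count have 2^(i-j) below x,
    and the last power available is 2^(n-1-j). The factor 1 - 2^(- q) turns a geometric sum into a
    telescoping one. *)
Lemma geometric_level_sum (x lam q : R) (j n : nat) :
  (0 <= x)%R -> (0 < lam)%R -> (0 < q)%R ->
  (\sum_(i < n) ((2 : R) ^ (i%:Z - j%:Z)%R < x)%R%:R *
     (((2 : R) ^ (i%:Z - j%:Z)%R / lam) `^ q * (1 - (2 : R) `^ (- q)))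
   <= (Num.min x ((2 : R) ^ (n%:Z - j%:Z) / 2) / lam) `^ q)%R.
Proof.
move=> x0 lam0 q0; elim: n => [|n IH]; first by rewrite big_ord0 powR_ge0.
rewrite big_ord_recr/=.
set a := ((2 : R) ^ (n%:Z - j%:Z))%R in IH *.
have a0 : (0 < a)%R by exact: exp2z_gt0.
have -> : ((2 : R) ^ (n.+1%:Z - j%:Z) / 2 = a)%R.
  have -> : (n.+1%:Z - j%:Z = (n%:Z - j%:Z) + 1)%R by rewrite intS; ring.
  by rewrite expfzDr// expr1z mulfK.
(* The summand telescopes: it is the increment of q-th powers of 2^i / lam. *)
have diff : ((a / lam) `^ q * (1 - (2 : R) `^ (- q)) = (a / lam) `^ q - (a / 2 / lam) `^ q)%R.
  have -> : (a / 2 / lam = a / lam * 2^-1)%R by ring.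
  rewrite mulrBr mulr1 (@powRM _ (a / lam)%R) ?invr_ge0 ?divr_ge0 ?(ltW a0) ?(ltW lam0)//.
  by rewrite -(powR_inv1 (ler0n R 2)) -powRrM mulN1r.
have [ax|xa] := ltP a x; last first.
  rewrite mul0r addr0 (le_trans IH)//; apply: ge0_ler_powR.
  - exact: ltW.
  - by rewrite nnegrE divr_ge0 ?(ltW lam0)// le_min x0 divr_ge0// ltW.
  - by rewrite nnegrE divr_ge0 ?(ltW lam0)//.
  - by rewrite ler_wpM2r ?invr_ge0 ?(ltW lam0)// ge_min lexx.
rewrite mul1r diff.
have : (\sum_(i < n) ((2 : R) ^ (i%:Z - j%:Z)%R < x)%R%:R *
     (((2 : R) ^ (i%:Z - j%:Z)%R / lam) `^ q * (1 - (2 : R) `^ (- q))) <= (a / 2 / lam) `^ q)%R.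
  apply: le_trans IH _; apply: ge0_ler_powR.
  - exact: ltW.
  - by rewrite nnegrE divr_ge0 ?(ltW lam0)// le_min x0 divr_ge0// ltW.
  - by rewrite nnegrE !divr_ge0 ?(ltW lam0) ?(ltW a0).
  - by rewrite ler_wpM2r ?invr_ge0 ?(ltW lam0)// ge_min lexx orbT.
lra.
Qed.

(** The sum of the geometric series of ratio 2^(- p^-), the slowest decay that the exponent
    allows. *)
Definition level_ratio : R := ((1 - (2 : R) `^ (- pm))^-1)%R.

Lemma level_ratio_gt0 (q : R) : (0 < q)%R -> (0 < 1 - (2 : R) `^ (- q))%R.
Proof.
move=> q0; rewrite subr_gt0 -(powRr0 (2 : R)) powRN powRr0 invf_lt1 ?powR_gt0//.
by rewrite -[ltLHS](powRr0 (2 : R)) /powR pnatr_eq0/= mul0r expR0 expR_gt1 mulr_gt0// ln_gt0// ltr1n.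
Qed.

Lemma sum_level_integral (lam : R) (n j : nat) : (0 < lam)%R ->
  \sum_(i < n) level_integral lam (i%:Z - j%:Z)%R <=
  level_ratio%:E * rho P p (fun w => s w * (lam^-1)%:E).
Proof.
move=> lam0.
have mi k : measurable_fun setT (fun w => ((2 ^ k / lam) `^ p w)%:E * (\1_(level k) w)%:E).
  apply/emeasurable_funM; first exact: measurable_powRc.
  exact/measurable_EFinP/measurable_indic/measurable_level.
have i0 k w : 0 <= ((2 ^ k / lam) `^ p w)%:E * (\1_(level k) w)%:E.
  by rewrite -EFinM lee_fin mulr_ge0 ?powR_ge0.
have lr0 : (0 < level_ratio)%R by rewrite invr_gt0 level_ratio_gt0// pminus_gt0.
rewrite (eq_bigr (fun i : 'I_n => \int[P]_w
    (((2 ^ (i%:Z - j%:Z)%R / lam) `^ p w)%:E * (\1_(level (i%:Z - j%:Z)%R) w)%:E))); last first.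
  by move=> i _; rewrite -integral_indic_mul setTI.
rewrite -ge0_integral_sum// -ge0_integralZl//; last 3 first.
- exact/measurable_fun_modular/measurable_scale.
- by move=> w _; exact: poweR_ge0.
- by rewrite lee_fin ltW.
apply: ae_ge0_le_integral => //.
- by move=> w _; apply: sume_ge0.
- by apply: emeasurable_sum.
- by move=> w _; rewrite mule_ge0 ?poweR_ge0// lee_fin ltW.
- apply/emeasurable_funM; first exact: measurable_cst.
  exact/measurable_fun_modular/measurable_scale.
apply: filterS exponent_ae => w /andP[pmw _] _.
have := s0 w; case sw : (s w) => [r| |]// r0; last first.
  rewrite abseM gt0_mulye ?poweRyr ?exponent_neq0// ?gt0_muley ?leey// ?lte_fin//.
  by rewrite ger0_norm ?invr_gt0 ?invr_ge0// ltW.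
rewrite lee_fin in r0.
have q0 := exponent_gt0 w; have c0 := level_ratio_gt0 q0.
have rl0 : (0 <= r / lam)%R by rewrite divr_ge0// ltW.
rewrite -(EFinM r) abse_EFin ger0_norm// poweR_EFin -(EFinM level_ratio).
under eq_bigr do rewrite -EFinM.
rewrite sumEFin lee_fin.
(* The factor 1 / (1 - 2^(- q)) decreases in q, so p^- gives the worst constant. *)
apply: (@le_trans _ _ ((1 - (2 : R) `^ (- p w))^-1 * (r / lam) `^ p w)%R); last first.
  rewrite ler_wpM2r ?powR_ge0// lef_pV2 ?posrE ?level_ratio_gt0 ?pminus_gt0//.
  by rewrite lerB// ler_powR ?ler1n// lerN2.
rewrite mulrC ler_pdivlMr// mulr_suml.
apply: le_trans (_ : ((Num.min r ((2 : R) ^ (n%:Z - j%:Z) / 2) / lam) `^ p w <= _)%R).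
  apply: le_trans (geometric_level_sum j n r0 lam0 q0).
  apply: ler_sum => i _; rewrite indicE.
  have -> : (w \in level (i%:Z - j%:Z)%R) = ((2 : R) ^ (i%:Z - j%:Z)%R < r)%R.
    by apply/idP/idP; rewrite inE /level/= sw lte_fin.
  by rewrite mulrAC mulrC.
apply: ge0_ler_powR; rewrite ?nnegrE ?(ltW q0)//.
  by rewrite divr_ge0 ?(ltW lam0)// le_min r0 divr_ge0// ltW// exp2z_gt0.
by rewrite ler_wpM2r ?invr_ge0 ?(ltW lam0)// ge_min lexx.
Qed.

(** At every admissible scale lam, theta_k / (2 lam) is the quantity bounded in [level_norm_le]. Its
    powers p^+ are thus at most the level integrals, which add up to at most [level_ratio]; this is
    where the constant comes from. *)
Lemma level_coef_lower :
  ((2 * level_ratio `^ pp^-1)^-1)%:E *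
    (\esum_(k in [set: int]) (level_coef k `^ pp)%:E) `^ pp^-1 <= vnorm P p s.
Proof.
have pp0 := pplus_gt0.
have lr0 : (0 < level_ratio)%R by rewrite invr_gt0 level_ratio_gt0// pminus_gt0.
have C0 : (0 < 2 * level_ratio `^ pp^-1)%R by rewrite mulr_gt0// powR_gt0.
apply: le_ereal_inf_tmp => _ [lam [lam0 rlam] <-].
rewrite lee_pdivrMl// -EFinM.
have l20 : (0 <= 2 * lam)%R by rewrite mulr_ge0// ltW.
have : \esum_(k in [set: int]) (level_coef k `^ pp)%:E <= ((2 * lam) `^ pp * level_ratio)%:E.
  apply: esum_int_le => [k|n j]; first by rewrite lee_fin powR_ge0.
  apply: (@le_trans _ _ (\sum_(i < n) ((2 * lam) `^ pp)%:E * level_integral lam (i%:Z - j%:Z)%R)).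
    apply: lee_sum => i _.
    apply: le_trans (lee_wpmul2l _ (level_norm_le _ lam0 rlam)); last first.
      by rewrite lee_fin powR_ge0.
    rewrite -EFinM lee_fin -powRM//.
      rewrite le_eqVlt; apply/orP; left; apply/eqP; congr (_ `^ _)%R.
      by rewrite /level_coef; field; rewrite gt_eqF.
    by rewrite divr_ge0 ?(ltW lam0)// mulr_ge0 ?level_norm_ge0// ltW ?exp2z_gt0.
  rewrite -ge0_sume_distrr; last by move=> i _; exact: level_integral_ge0.
  rewrite EFinM lee_wpmul2l ?lee_fin ?powR_ge0//.
  apply: le_trans (sum_level_integral n j lam0) _.
  by rewrite -[leRHS]mule1 lee_wpmul2l// lee_fin ltW.
have e0 : 0 <= \esum_(k in [set: int]) (level_coef k `^ pp)%:E.
  by apply: esum_ge0 => k _; rewrite lee_fin powR_ge0.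
move=> le; apply: le_trans (_ : ((2 * lam) `^ pp * level_ratio)%:E `^ pp^-1 <= _).
  apply: gt0_ler_poweR le; rewrite ?in_itv/= ?leey ?andbT ?invr_ge0 ?(ltW pp0)//.
  by rewrite lee_fin mulr_ge0 ?powR_ge0// ltW.
rewrite poweR_EFin lee_fin powRM ?powR_ge0 ?(ltW lr0)//.
by rewrite -powRrM mulfV ?gt_eqF// powRr1// mulrAC.
Qed.

Lemma exp2z_unbounded (x : R) : exists n : nat, (x <= 2 ^ n%:Z)%R.
Proof.
exists (Num.truncn `|x|).+1; apply: le_trans (ler_norm _) _.
apply: le_trans (ltW (truncnS_gt _)) _.
by rewrite -exprnP -natrX ler_nat ltnW// ltn_expl.
Qed.

Lemma level_bracket (x : R) (m n : nat) :
  ((2 : R) ^ (- n%:Z)%R < x <= 2 ^ (m%:Z - n%:Z)%R)%R ->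
  exists2 i, (i < m)%N & ((2 : R) ^ (i%:Z - n%:Z)%R < x <= 2 * 2 ^ (i%:Z - n%:Z)%R)%R.
Proof.
elim: m => [|m IH]; first by rewrite sub0r => /andP[a]; rewrite leNgt a.
move=> /andP[x1 x2]; have [xm|xm] := leP x (2 ^ (m%:Z - n%:Z)%R)%R.
  by have [|i im ix] := IH; [rewrite x1|exists i => //; exact: ltnW].
exists m => //; rewrite xm/= (le_trans x2)//.
have -> : (m.+1%:Z - n%:Z = 1 + (m%:Z - n%:Z))%R by rewrite intS; ring.
by rewrite expfzDr// expr1z.
Qed.

(** Write 2^k / L as theta_k / L times 1 / (2N), with N the norm of the indicator. The first factor
    is at most 1, so its power p is at most its power p^-; the second has modular at most 1 on the
    level set because 2N > N. The factor 2 in theta_k supplies this strict inequality. *)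
Lemma level_integral_le_coef (L : R) (k : int) : (0 < L)%R -> (level_coef k <= L)%R ->
  level_integral L k <= ((level_coef k / L) `^ pm)%:E.
Proof.
move=> L0 cL; have k0 := exp2z_gt0 k; have mk := measurable_level k.
have x0 : (0 <= level_coef k / L)%R by rewrite divr_ge0 ?level_coef_ge0// ltW.
have [N0|N_neq0] := eqVneq (fine (vnorm P p (EFin \o \1_(level k)))) 0%R.
  rewrite /level_integral null_set_integral ?lee_fin ?powR_ge0//.
    exact: measurable_powRc.
  by apply: vnorm_indic_eq0 => //; rewrite level_norm_fin N0.
set N := fine _ in N_neq0.
have N0 : (0 < N)%R by rewrite lt_neqAle eq_sym N_neq0 level_norm_ge0.
have [_] : (0 < 2 * N)%R /\ rho P p (fun w => (\1_(level k) w)%:E * ((2 * N)^-1)%:E) <= 1.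
  apply: vnorm_lt; first exact/measurable_EFinP/measurable_indic.
  by rewrite level_norm_fin -/N lte_fin ltr_pMl// ltr1n.
rewrite rho_indicM ?invr_ge0 ?mulr_ge0 ?(ltW N0)// => le1.
apply: (@le_trans _ _ (\int[P]_(w in level k)
    (((level_coef k / L) `^ pm)%:E * ((2 * N)^-1 `^ p w)%:E))).
  apply: ae_ge0_le_integral => //.
  - by move=> w _; rewrite lee_fin powR_ge0.
  - exact: measurable_powRc.
  - by move=> w _; rewrite -EFinM lee_fin mulr_ge0 ?powR_ge0.
  - by apply/emeasurable_funM; [exact: measurable_cst|exact: measurable_powRc].
  apply: filterS exponent_ae => w /andP[pmw _] _.
  have -> : (2 ^ k / L = (level_coef k / L) * (2 * N)^-1)%R.
    by rewrite /level_coef -/N; field; rewrite !gt_eqF.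
  rewrite -EFinM lee_fin powRM//; last by rewrite invr_ge0 mulr_ge0// ltW.
  rewrite ler_wpM2r ?powR_ge0//; apply: ger_powR => //.
  rewrite divr_gt0//= ?ler_pdivrMr ?mul1r//.
  by rewrite /level_coef -/N !mulr_gt0.
rewrite (ge0_integralZl P mk); first last.
- by rewrite lee_fin powR_ge0.
- by move=> w _; rewrite lee_fin powR_ge0.
- exact: measurable_powRc.
by rewrite -[leRHS]mule1 lee_wpmul2l// lee_fin powR_ge0.
Qed.

(** On the shell 2^k < s <= 2^(k+1) one has s / (2L) <= 2^k / L. The modular of s at scale 2L is
    therefore at most the sum of the level integrals at scale L, hence at most the sum of (theta_k /
    L)^(p^-). *)
Lemma vnorm_le_level_coef (L : R) : {ae P, forall w, s w < +oo} -> (0 < L)%R ->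
  \esum_(k in [set: int]) (level_coef k `^ pm)%:E <= (L `^ pm)%:E ->
  vnorm P p s <= (2 * L)%:E.
Proof.
move=> soo L0 SL; have pm0 := pminus_gt0.
have Lpm : (0 < L `^ pm)%R by rewrite powR_gt0.
have L20 : (0 < 2 * L)%R by rewrite mulr_gt0.
have coefL k : (level_coef k <= L)%R.
  have : (level_coef k `^ pm)%:E <= (L `^ pm)%:E.
    apply: le_trans SL; apply: esum_ge; exists [set k].
      by split => //; exact: finite_set1.
    by rewrite fsbig_set1.
  rewrite lee_fin; apply: contraTT; rewrite -!ltNge => Lk.
  by apply: gt0_ltr_powR => //; rewrite nnegrE ?level_coef_ge0// ltW.
apply: vnorm_le => //.
pose f w := `|s w * ((2 * L)^-1)%:E| `^ p w.
have mf : measurable_fun setT f by exact/measurable_fun_modular/measurable_scale.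
have f0 w : 0 <= f w by exact: poweR_ge0.
(* D n is covered by the 2n + 1 shells 2^k < s <= 2^(k+1) with - n <= k <= n, and the sets D n
   increase to {0 < s < oo}. *)
pose D (n : nat) := [set w | ((2 : R) ^ (- n%:Z)%R)%:E < s w] `&`
  [set w | s w <= ((2 : R) ^ ((n + n).+1%:Z - n%:Z)%R)%:E].
have mD n : measurable (D n).
  apply: measurableI; first exact: measurable_level.
  by rewrite -[X in measurable X]setTI; exact: emeasurable_fun_infty_c.
have intD n : \int[P]_(w in D n) f w <= 1.
  apply: (@le_trans _ _ (\sum_(i < (n + n).+1) level_integral L (i%:Z - n%:Z)%R)); last first.
    apply: (@le_trans _ _
        (\sum_(i < (n + n).+1) ((L `^ pm)^-1)%:E * (level_coef (i%:Z - n%:Z)%R `^ pm)%:E)).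
      apply: lee_sum => i _; apply: le_trans (level_integral_le_coef L0 (coefL _)) _.
      rewrite -EFinM lee_fin powRM ?level_coef_ge0 ?invr_ge0 ?(ltW L0)//.
      have -> : (L^-1 `^ pm = (L `^ pm)^-1)%R.
        by rewrite -(powR_inv1 (ltW L0)) -powRrM mulN1r powRN.
      by rewrite mulrC.
    rewrite -ge0_sume_distrr; last by move=> i _; rewrite lee_fin powR_ge0.
    rewrite lee_pdivrMl// mule1; apply: le_trans SL.
    exact: (le_esum_int (fun k => (level_coef k `^ pm)%:E)).
  have mi k : measurable_fun setT (fun w => ((2 ^ k / L) `^ p w)%:E * (\1_(level k) w)%:E).
    apply/emeasurable_funM; first exact: measurable_powRc.
    exact/measurable_EFinP/measurable_indic/measurable_level.
  have i0 k w : 0 <= ((2 ^ k / L) `^ p w)%:E * (\1_(level k) w)%:E.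
    by rewrite -EFinM lee_fin mulr_ge0 ?powR_ge0.
  apply: (@le_trans _ _ (\sum_(i < (n + n).+1) \int[P]_w
    (((2 ^ (i%:Z - n%:Z)%R / L) `^ p w)%:E * (\1_(level (i%:Z - n%:Z)%R) w)%:E))); last first.
    by apply: lee_sum => i _; rewrite -integral_indic_mul setTI.
  rewrite -ge0_integral_sum// [leLHS]integral_mkcond; apply: ge0_le_integral => //.
  - by move=> w _; exact: erestrict_ge0.
  - exact/(measurable_restrictT _ _).1/measurable_funTS.
  - by apply: emeasurable_sum.
  move=> w _; rewrite patchE; case: ifPn => [/set_mem[]|_]/=; last by apply: sume_ge0.
  rewrite /f; have := s0 w; case sw : (s w) => [r| |]//; rewrite !(lte_fin,lee_fin) => r0 r1 r2.
  have [i im /andP[i1 i2]] := level_bracket (introT andP (conj r1 r2)).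
  rewrite (bigD1 (Ordinal im))//= -[leLHS]adde0 leeD//; last by apply: sume_ge0.
  rewrite indicE mem_set; last by rewrite /level/= sw lte_fin.
  rewrite mule1 lee_fin ger0_norm ?divr_ge0 ?(ltW L20)//.
  apply: ge0_ler_powR; rewrite ?nnegrE ?divr_ge0 ?(ltW L20) ?(ltW L0) ?(ltW (exp2z_gt0 _))//.
    exact/ltW/exponent_gt0.
  by rewrite ler_pdivrMr// (le_trans i2)// le_eqVlt; apply/orP; left; apply/eqP; field; rewrite gt_eqF.
have ndD : nondecreasing_seq D.
  move=> a b ab; apply/subsetPset => w [/= w1 w2]; split => /=.
    by apply: le_lt_trans w1; rewrite lee_fin ler_weXz2l ?ler1n//; lia.
  by apply: (le_trans w2); rewrite lee_fin ler_weXz2l ?ler1n//; lia.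
have cvgD := ge0_nondecreasing_set_cvg_integral ndD mD
  (fun i => measurable_funTS mf) (fun i w _ => f0 w) (mu := P).
have mUD : measurable (\bigcup_i D i) by exact: bigcup_measurable.
have -> : rho P p (fun w => s w * ((2 * L)^-1)%:E) = \int[P]_(w in \bigcup_i D i) f w.
  rewrite [RHS]integral_mkcond; apply: ge0_ae_eq_integral => //.
  - exact/(measurable_restrictT _ _).1/measurable_funTS.
  - by move=> w _; exact: f0.
  - by move=> w _; apply: erestrict_ge0 => x _.
  apply: filterS soo => w; have := s0 w; case sw : (s w) => [r| |]// + _ _.
  have fE : f w = `|r%:E * ((2 * L)^-1)%:E| `^ p w by rewrite /f sw.
  rewrite lee_fin le_eqVlt patchE fE => /predU1P[r0|r0]; case: ifPn => [//|nw].
    by rewrite -r0 mul0e abse0 poweR0r ?exponent_neq0.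
  exfalso; move: nw; rewrite notin_setE; apply.
  have [n1 n1r] := exp2z_unbounded r; have [n2 n2r] := exp2z_unbounded r^-1.
  exists (maxn n1 n2).+1 => //; split => /=; rewrite sw ?lte_fin ?lee_fin.
    rewrite -invr_expz invf_plt ?posrE ?exp2z_gt0//.
    by rewrite (le_lt_trans n2r)// ltr_eXz2l ?ltr1n//; lia.
  by rewrite (le_trans n1r)// ler_weXz2l ?ler1n//; lia.
have <- := cvg_lim (@ereal_hausdorff _) cvgD.
apply: lime_le; first by apply/cvg_ex; eexists; exact: cvgD.
exact: nearW.
Qed.

Lemma level_coef_upper : {ae P, forall w, s w < +oo} ->
  vnorm P p s <= 2%:E * (\esum_(k in [set: int]) (level_coef k `^ pm)%:E) `^ pm^-1.
Proof.
move=> soo; have pm0 := pminus_gt0.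
have S0 : 0 <= \esum_(k in [set: int]) (level_coef k `^ pm)%:E.
  by apply: esum_ge0 => k _; rewrite lee_fin powR_ge0.
have [Soo|Sfin] := eqVneq (\esum_(k in [set: int]) (level_coef k `^ pm)%:E) +oo.
  by rewrite Soo poweRyr ?gt0_muley ?leey ?lte_fin// gt_eqF// invr_gt0.
set S := esum _ _ in S0 Sfin *.
have SE : S = (fine S)%:E by rewrite fineK// ge0_fin_numE// ltey.
(* The scale L must be positive, so a vanishing sum is reached through arbitrarily small L. *)
have [S_eq0|S_neq0] := eqVneq (fine S) 0%R.
  rewrite SE S_eq0 poweR0r ?mule0 ?gt_eqF ?invr_gt0//.
  apply/lee_addgt0Pr => e e0; rewrite add0e.
  have -> : e = (2 * (e / 2))%R by rewrite mulrC divfK.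
  apply: vnorm_le_level_coef => //; first by rewrite divr_gt0.
  by rewrite -/S SE S_eq0 lee_fin powR_ge0.
have fS0 : (0 < fine S)%R by rewrite lt_neqAle eq_sym S_neq0 fine_ge0.
rewrite SE poweR_EFin -EFinM; apply: vnorm_le_level_coef => //; first by rewrite powR_gt0.
by rewrite -/S {1}SE -powRrM mulVf ?gt_eqF// powRr1// ltW.
Qed.

(** A finite norm makes the modular finite at one scale g. Boundedness of p carries this to every
    scale e, at the cost of the factor max(1, g/e)^(p^+). *)
Lemma integrable_modular (e : R) : (0 < e)%R -> vnorm P p s < +oo ->
  P.-integrable setT (fun w => `|s w * (e^-1)%:E| `^ p w).
Proof.
move=> e0 soo.
have [g ug] : exists g : R, vnorm P p s < g%:E.
  exists (fine (vnorm P p s) + 1)%R; rewrite EFinD fineK.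
    by rewrite lteDl// ?ge0_fin_numE ?vnorm_ge0// lte_fin.
  by rewrite ge0_fin_numE ?vnorm_ge0.
have [g0 rg] := vnorm_lt ms ug.
have mm c : measurable_fun setT (fun w => `|s w * c%:E| `^ p w).
  exact/measurable_fun_modular/measurable_scale.
apply/integrableP; split; first exact: mm.
under eq_integral do rewrite gee0_abs ?poweR_ge0//.
pose K := Num.max 1%R (g / e)%R.
have K1 : (1 <= K)%R by rewrite le_max lexx.
apply: (@le_lt_trans _ _ (\int[P]_w ((K `^ pp)%:E * `|s w * (g^-1)%:E| `^ p w))).
  apply: ae_ge0_le_integral => //.
  - by move=> w _; exact: poweR_ge0.
  - by move=> w _; rewrite mule_ge0 ?poweR_ge0// lee_fin powR_ge0.
  - by apply/emeasurable_funM; [exact: measurable_cst|exact: mm].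
  apply: filterS exponent_ae => w /andP[_ ppw] _.
  have -> : s w * (e^-1)%:E = (g / e)%:E * (s w * (g^-1)%:E).
    rewrite muleCA -EFinM; congr (_ * _%:E).
    by field; rewrite !gt_eqF.
  rewrite abseM poweRM ?abse_ge0// lee_wpmul2r ?poweR_ge0//.
  rewrite abse_EFin poweR_EFin lee_fin ger0_norm ?divr_ge0 ?(ltW g0) ?(ltW e0)//.
  apply: (@le_trans _ _ (K `^ p w)%R); last exact: ler_powR.
  have K0 : (0 <= K)%R := le_trans ler01 K1.
  apply: ge0_ler_powR; rewrite ?nnegrE ?K0 ?divr_ge0 ?(ltW g0) ?(ltW e0)//.
    exact/ltW/exponent_gt0.
  by rewrite le_max lexx orbT.
rewrite ge0_integralZl//; first last.
- by rewrite lee_fin powR_ge0.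
- by move=> w _; exact: poweR_ge0.
apply: (@le_lt_trans _ _ ((K `^ pp)%:E * 1)); last by rewrite mule1 ltry.
by rewrite lee_wpmul2l// lee_fin powR_ge0.
Qed.

(** The bound on u is the one obtained for the square function of the remainder. At scale e the
    modular has two halves: where s <= 2^(m+1) the small constant 2^(- j) rules, and elsewhere the
    tail of an integrable function does, by dominated convergence. *)
Lemma vnorm_tail (e : R) : (0 < e)%R -> vnorm P p s < +oo ->
  exists J M : nat, forall (j m : nat) (u : T -> \bar R),
    (J <= j)%N -> (M <= m)%N -> measurable_fun setT u ->
    {ae P, forall w, `|u w| <=
       if s w <= ((2 : R) ^ m.+1%:Z)%:E then ((2 : R) ^ (- j%:Z)%R)%:E else s w} ->
    vnorm P p u <= e%:E.
Proof.
move=> e0 soo; pose f w := `|s w * (e^-1)%:E| `^ p w.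
have if_ := integrable_modular e0 soo; rewrite -/f in if_.
have mf := measurable_int _ if_.
have f0 w : 0 <= f w by exact: poweR_ge0.
pose f_ (n : nat) := f \_ (level n%:Z).
have mf_ n : measurable_fun setT (f_ n).
  by apply/(measurable_restrictT _ (measurable_level _)).1/measurable_funTS.
have f_0 n w : 0 <= f_ n w by apply: erestrict_ge0 => x _; exact: f0.
have f_cvg : {ae P, forall w, setT w -> f_ ^~ w @ \oo --> cst 0 w}.
  apply: filterS (vnorm_lty_ae ms soo) => w sw _.
  have [r rE] : exists r : R, s w = r%:E.
    by move: sw (s0 w); case: (s w) => // r _ _; exists r.
  have [n rn] := exp2z_unbounded r.
  apply: cvg_near_cst; exists n => // k /= nk; rewrite /f_ patchE memNset//.
  rewrite /level/= rE lte_fin; apply/negP; rewrite -leNgt (le_trans rn)//.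
  by rewrite ler_weXz2l ?ler1n.
have f_le : {ae P, forall w n, setT w -> `|f_ n w| <= f w}.
  apply/nearW => w n _; rewrite gee0_abs// /f_ patchE.
  by case: ifPn.
have mc0 : measurable_fun setT (cst 0 : T -> \bar R) by exact: measurable_cst.
have [_ _ cvg_int] := dominated_convergence measurableT mf_ mc0 f_cvg if_ f_le.
rewrite integral0 in cvg_int.
have /cvg_int[M _ HM] : nbhs (0 : \bar R) [set x | x <= (2^-1)%:E].
  have : nbhs (0 : \bar R) [set x | x < (2^-1)%:E].
    by apply: (@nbhs_open_ereal_lt R 0%R (fun=> 2^-1)%R); rewrite invr_gt0.
  by apply: filterS => x /ltW.
(* Chosen so that del <= 1 and del^p <= del^(p^-) = 1/2; the other half of the modular is left to
   the tail. *)
pose del := ((2^-1 : R) `^ pm^-1)%R.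
have pm0 := pminus_gt0.
have d0 : (0 < del)%R by rewrite powR_gt0 ?invr_gt0.
have d1 : (del <= 1)%R.
  rewrite -[leRHS](congr1 (fun f => f pm^-1%R) (@powR1 R)) ge0_ler_powR ?nnegrE ?invr_ge0 ?(ltW pm0)//.
  by rewrite invf_le1// ler1n.
have dpm : (del `^ pm = 2^-1)%R by rewrite -powRrM mulVf ?gt_eqF// powRr1 ?invr_ge0.
have [J HJ] := exp2z_unbounded (del * e)^-1%R.
exists J, M => j m u Jj Mm mu uP.
have mue : measurable_fun setT (fun w => u w * (e^-1)%:E).
  by apply/emeasurable_funM => //; exact: measurable_cst.
apply: vnorm_le => //.
apply: (@le_trans _ _ (\int[P]_w ((2^-1)%:E + f_ m.+1 w))); last first.
  rewrite ge0_integralD//.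
  rewrite integral_cst//; rewrite [X in _ * X + _](probability_setT P) mule1.
  have := HM m.+1 (leqW Mm) => /= le2.
  apply: (le_trans (leeD2l _ le2)); rewrite -EFinD lee_fin.
  lra.
apply: ae_ge0_le_integral => //.
- by move=> w _; exact: poweR_ge0.
- exact: measurable_fun_modular.
- by move=> w _; rewrite adde_ge0// lee_fin invr_ge0.
- apply/emeasurable_funD => //; exact: measurable_cst.
apply: filterS2 uP exponent_ae => w + /andP[pmw _] _.
case: ifPn => [sm|sm] uw.
  apply: (@le_trans _ _ (2^-1)%:E); last by rewrite leeDl.
  apply: (@le_trans _ _ (`|(del * e)%:E * (e^-1)%:E| `^ p w)).
    apply: le_modular; rewrite !abseM lee_wpmul2r ?abse_ge0//.
    rewrite (le_trans uw)// abse_EFin lee_fin ger0_norm ?mulr_ge0 ?(ltW d0) ?(ltW e0)//.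
    have de0 : (0 < del * e)%R by rewrite mulr_gt0.
    rewrite -invr_expz invf_ple ?posrE ?exp2z_gt0//.
    by rewrite (le_trans HJ)// ler_weXz2l ?ler1n.
  rewrite -EFinM mulfK ?gt_eqF// abse_EFin gtr0_norm// poweR_EFin lee_fin -dpm.
  by apply: ger_powR => //; rewrite d0.
rewrite /f_ patchE mem_set; last by rewrite /level/= ltNge.
apply: (@le_trans _ _ (f w)); last by rewrite leeDr// lee_fin invr_ge0.
by apply: le_modular; rewrite !abseM lee_wpmul2r ?abse_ge0// [leRHS]gee0_abs.
Qed.

End level_sets.

End exponent.

(** * Predictable transforms of martingales *)

Section L1_limit.
Context d (T : measurableType d) (R : realType) (P : probability T R).
Local Open Scope ereal_scope.

(** Summable L^1 increments make |H_0| + sum of |H_(k+1) - H_k| an integrable majorant D. Where D is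
    finite the sequence converges, and dominated convergence passes to the limit on every measurable
    set. *)
Lemma integrable_fast_cauchy_limit (H : nat -> T -> R) :
  (forall k, measurable_fun setT (H k)) -> P.-integrable setT (EFin \o H 0%N) ->
  (forall k, \int[P]_w (`|H k.+1 w - H k w|)%:E <= (1 / (2 ^ k.+1)%:R)%:E) ->
  exists a : T -> R, P.-integrable setT (EFin \o a) /\
    forall A, measurable A ->
      \int[P]_(w in A) (H k w)%:E @[k --> \oo] --> \int[P]_(w in A) (a w)%:E.
Proof.
move=> mH iH0 Hk.
have mE k : measurable_fun setT (EFin \o H k) by exact/measurable_EFinP.
pose D w := `|H 0%N w|%:E + \sum_(0 <= k <oo) (`|H k.+1 w - H k w|)%:E.
have mdiff k : measurable_fun setT (fun w => (`|H k.+1 w - H k w|)%:E : \bar R).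
  by apply/measurable_EFinP/measurableT_comp => //; exact: measurable_funB.
have mseries : measurable_fun setT (fun w => \sum_(0 <= k <oo) (`|H k.+1 w - H k w|)%:E).
  by apply: ge0_emeasurable_sum => [k w _ _|k _] //; rewrite lee_fin.
have series0 w : 0 <= \sum_(0 <= k <oo) (`|H k.+1 w - H k w|)%:E.
  by apply: nneseries_ge0 => k _ _; rewrite lee_fin.
have mD0 : measurable_fun setT (fun w => `|H 0%N w|%:E : \bar R).
  by apply/measurable_EFinP/measurableT_comp.
have mD : measurable_fun setT D by exact: emeasurable_funD.
have D0 w : 0 <= D w by rewrite adde_ge0// lee_fin.
have iD : P.-integrable setT D.
  apply/integrableP; split => //.
  under eq_integral do rewrite gee0_abs//.
  rewrite ge0_integralD//.
  rewrite lte_add_pinfty//.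
    by case/integrableP: iH0 => _; apply: le_lt_trans; exact: ge0_le_integral.
  rewrite integral_nneseries//.
  apply: (@le_lt_trans _ _ (\sum_(0 <= k <oo) (1 / (2 ^ k.+1)%:R)%:E)).
    apply: lee_nneseries => k _; last exact: Hk.
    by move=> _; apply: integral_ge0 => w _; rewrite lee_fin.
  exact: le_lt_trans (epsilon_trick0 _ ler01) (ltry _).
have Dlt : {ae P, forall w, D w < +oo}.
  have := integrable_ae measurableT iD.
  by apply: filterS => w /(_ I); rewrite ge0_fin_numE.
have HD k w : `|(H k w)%:E| <= D w.
  rewrite /D abse_EFin.
  have -> : H k w = (H 0%N w + \sum_(0 <= i < k) (H i.+1 w - H i w))%R.
    by rewrite telescope_sumr// addrC subrK.
  apply: le_trans (_ : (`|H 0%N w| + \sum_(0 <= i < k) `|H i.+1 w - H i w|)%:E <= _).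
    by rewrite lee_fin (le_trans (ler_normD _ _))// lerD2l ler_norm_sum.
  rewrite EFinD leeD2l// -sumEFin.
  by apply: nneseries_lim_ge => n _ _; rewrite lee_fin.
have Hcvg w : D w < +oo -> cvgn (H ^~ w).
  move=> Dw; have sw : \sum_(0 <= k <oo) (`|H k.+1 w - H k w|)%:E < +oo.
    by apply: le_lt_trans Dw; rewrite /D leeDr// lee_fin.
  have : cvgn (series (telescope (H ^~ w))).
    apply: normed_cvg; rewrite /normed_series_of.
    exact: (nnseries_is_cvg _ sw).
  move=> cs; rewrite (_ : H ^~ w = fun n => H 0%N w + series (telescope (H ^~ w)) n)%R.
    by apply: is_cvgD => //; exact: is_cvg_cst.
  by apply/funext => n; exact: (eq_sum_telescope (H ^~ w)).
(* The upper limit is defined and measurable everywhere; it is a true finite limit where D is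
   finite. *)
pose a' w := limn_esup (fun k => (H k w)%:E).
have ma' : measurable_fun setT a'.
  exact: (@measurable_fun_limn_esup _ _ _ setT (fun k w => (H k w)%:E)).
have Ha' w : D w < +oo -> (H k w)%:E @[k --> \oo] --> (fine (a' w))%:E.
  move=> Dw; have cH := Hcvg w Dw.
  have cE : (H k w)%:E @[k --> \oo] --> (limn (H ^~ w))%:E.
    by apply: cvg_EFin => //; exact: nearW.
  rewrite /a' is_cvg_limn_esupE; last by apply/cvg_ex; eexists; exact: cE.
  by rewrite (cvg_lim _ cE).
exists (fine \o a').
have maE : measurable_fun setT (EFin \o (fine \o a')).
  by apply/measurable_EFinP/measurableT_comp.
have cvgA : {ae P, forall w, setT w -> (EFin \o H k) w @[k --> \oo] --> (EFin \o (fine \o a')) w}.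
  by apply: filterS Dlt => w Dw _; exact: Ha'.
have leA : {ae P, forall w k, setT w -> `|(EFin \o H k) w| <= D w}.
  by apply/nearW => w k _; exact: HD.
split; first by have [] := dominated_convergence measurableT mE maE cvgA iD leA.
move=> A mA; have [_ _] := dominated_convergence mA
  (fun k => measurable_funTS (mE k)) (measurable_funTS maE)
  (filterS (fun w h _ => h I) cvgA) (integrableS measurableT mA (@subsetT _ _) iD)
  (filterS (fun w h k _ => h k I) leA).
by [].
Qed.

End L1_limit.

(** * Conditional square functions along a filtration *)

Section filtrations.
Context d (T : measurableType d) (R : realType) (P : probability T R).
Context (F : nat -> set (set T)) (Ffilt : is_filtration F).
Local Open Scope ereal_scope.

Lemma sigma_algebra_filt k : sigma_algebra setT (filt F k).
Proof.
case: Ffilt => sF _ _ _; case: k => n /=; first exact: sF.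
split.
- by left.
- by move=> A [->|->]; rewrite setTD ?setC0 ?setCT; [right|left].
- move=> A AF; have [[i Ai]|nA] := pselect (exists i, A i = setT).
    by right; apply/seteqP; split => // w _; exists i => //; rewrite Ai.
  left; apply/seteqP; split => // w [i _ Aiw].
  by case: (AF i) => Ai; [rewrite Ai in Aiw|case: nA; exists i].
Qed.

Lemma filt_measurable k : filt F k `<=` measurable.
Proof.
case: Ffilt => _ sF _ _; case: k => n /=; first exact: sF.
by move=> A [->|->]; [exact: measurable0|exact: measurableT].
Qed.

Lemma le_filt (k l : int) : (k <= l)%R -> filt F k `<=` filt F l.
Proof.
have triv l' : filt F l' set0 /\ filt F l' setT.
  have [s0 sC _] := sigma_algebra_filt l'.
  by split => //; rewrite -(setD0 setT); exact: sC.
case: k => m kl; last by move=> A [->|->]; have [] := triv l.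
by case: l kl => // n; case: Ffilt => _ _ + _; apply.
Qed.

Definition past_filt (n : nat) := filt F (n%:Z - 1)%R.

Lemma past_filtS n : past_filt n.+1 = F n.
Proof. by rewrite /past_filt intS addrAC subrr add0r. Qed.

Lemma sigma_algebra_past n : sigma_algebra setT (past_filt n).
Proof. exact: sigma_algebra_filt. Qed.

Lemma past_measurable n : past_filt n `<=` measurable.
Proof. exact: filt_measurable. Qed.

Lemma past_sub_filt n : past_filt n `<=` F n.
Proof. by apply: (@le_filt _ n%:Z); rewrite gerBl. Qed.

Lemma le_past (m n : nat) : (m <= n)%N -> past_filt m `<=` past_filt n.
Proof. by move=> mn; apply: le_filt; rewrite lerB. Qed.

Lemma filt_nat_measurable n : F n `<=` measurable.
Proof. exact: (@filt_measurable n%:Z). Qed.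

Lemma sigma_algebra_filt_nat n : sigma_algebra setT (F n).
Proof. exact: (@sigma_algebra_filt n%:Z). Qed.

Definition cond_square (f : nat -> T -> R) n : T -> \bar R :=
  condexp P (past_filt n) (fun w => (`|mdiff f n w| ^+ 2)%:E).

Lemma csquareE f w :
  csquare P F f w = (\sum_(0 <= n <oo) cond_square f n w) `^ 2^-1.
Proof. by []. Qed.

Section measurable_process.
Context (f : nat -> T -> R) (mf : forall n, measurable_fun setT (f n)).

Lemma measurable_mdiff n : measurable_fun setT (mdiff f n).
Proof. by case: n => [|n] /=; [exact: mf|exact: measurable_funB]. Qed.

Lemma measurable_mdiff2 n : measurable_fun setT (fun w => `|mdiff f n w| ^+ 2)%R.
Proof. by apply/measurable_funX/measurableT_comp => //; exact: measurable_mdiff. Qed.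

Lemma cond_squareP n : is_condexp P (past_filt n)
  (fun w => (`|mdiff f n w| ^+ 2)%:E) (cond_square f n).
Proof.
apply: (@condexp_ge0P _ _ _ P _ (sigma_algebra_past n) (@past_measurable n)
  (fun w => `|mdiff f n w| ^+ 2)%R).
  exact: measurable_mdiff2.
by move=> w; rewrite exprn_ge0.
Qed.

Lemma cond_square_ge0 n w : 0 <= cond_square f n w.
Proof. by case: (cond_squareP n) => _ + _; apply => x; rewrite lee_fin exprn_ge0. Qed.

Lemma measurable_wrt_cond_square n : measurable_wrt (past_filt n) (cond_square f n).
Proof. by case: (cond_squareP n). Qed.

Lemma measurable_cond_square n : measurable_fun setT (cond_square f n).
Proof. exact: (measurable_wrt_fun (@past_measurable n) (measurable_wrt_cond_square n)). Qed.

Lemma measurable_csquare : measurable_fun setT (csquare P F f).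
Proof.
apply: (measurableT_comp (measurable_poweR _)).
apply: ge0_emeasurable_sum => [n w _ _|n _]; first exact: cond_square_ge0.
exact: measurable_cond_square.
Qed.

End measurable_process.

(** Predictability of B lets its indicator leave the conditional expectation. The lemma serves the
    atoms, where B is a band and c = 1 / theta_k, and the remainder, where B is the complement of a
    wide band and c = 1. *)
Lemma csquare_indic (f h : nat -> T -> R) (B : nat -> set T) (c : R) :
  (forall n, measurable_fun setT (f n)) -> (forall n, measurable_fun setT (h n)) ->
  (forall n, past_filt n (B n)) -> (0 <= c)%R ->
  (forall n, {ae P, forall w, mdiff h n w = c * (\1_(B n) w * mdiff f n w)}%R) ->
  {ae P, forall w, csquare P F h w =
    c%:E * (\sum_(0 <= n <oo) (\1_(B n) w)%:E * cond_square f n w) `^ 2^-1}.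
Proof.
move=> mf mh GB c0 hf.
have step n : {ae P, forall w, cond_square h n w =
    (c ^+ 2)%:E * ((\1_(B n) w)%:E * cond_square f n w)}.
  have mB : measurable_fun setT (\1_(B n) : T -> R).
    exact/measurable_indic/past_measurable.
  have -> : cond_square h n = condexp P (past_filt n)
      (fun w => (c ^+ 2 * (\1_(B n) w * `|mdiff f n w| ^+ 2))%:E).
    apply: eq_ae_condexp.
    - exact: past_measurable.
    - exact: measurable_mdiff2.
    - by do 2!apply: measurable_funM => //; exact: measurable_mdiff2.
    - by move=> w; rewrite exprn_ge0.
    - by move=> w; rewrite !mulr_ge0 ?exprn_ge0.
    apply: filterS (hf n) => w ->; rewrite !normrM (ger0_norm c0) !exprMn.
    by rewrite indicE; case: (w \in B n); rewrite ?normr1 ?normr0 ?expr1n ?expr0n.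
  apply: (@condexp_indicM _ _ _ P _ (sigma_algebra_past n) (@past_measurable n)
    (fun w => `|mdiff f n w| ^+ 2)%R (B n) (c ^+ 2)%R) => //.
  - exact: measurable_mdiff2.
  - by rewrite sqr_ge0.
apply: filterS (ae_foralln step) => w hw; rewrite csquareE.
under eq_eseriesr do rewrite hw.
rewrite nneseriesZl//; last first.
  by move=> n _; rewrite mule_ge0 ?lee_fin// cond_square_ge0.
rewrite poweRM ?lee_fin ?exprn_ge0//; last first.
  by apply: nneseries_ge0 => n _ _; rewrite mule_ge0 ?lee_fin// cond_square_ge0.
congr (_ * _); rewrite poweR_EFin powR12_sqrt ?exprn_ge0//.
by rewrite sqrtr_sqr ger0_norm.
Qed.

Section martingale_transform.
Context (f : nat -> T -> R) (fM : is_martingale P F f).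
Context (B : nat -> set T) (GB : forall n, past_filt n (B n)).

Lemma martingale_adapted n : measurable_wrt (F n) (f n).
Proof. by case: fM. Qed.

Lemma martingale_measurable n : measurable_fun setT (f n).
Proof. exact: (measurable_wrt_fun (@filt_nat_measurable n) (martingale_adapted n)). Qed.

Lemma martingale_integrable n : P.-integrable setT (EFin \o f n).
Proof. by case: fM. Qed.

Lemma integral_martingale m n A : (m <= n)%N -> F m A ->
  \int[P]_(w in A) (f n w)%:E = \int[P]_(w in A) (f m w)%:E.
Proof.
move=> mn FA; case: fM => _ int ce.
rewrite -(integral_condexpR (sigma_algebra_filt_nat m) (@filt_nat_measurable m) (int n) FA).
apply: ae_eq_integral.
- exact: (filt_nat_measurable FA).
- apply/measurable_funTS/measurable_EFinP.
  apply: (measurable_wrt_fun (@filt_nat_measurable m)).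
  exact: (measurable_wrt_condexpR (sigma_algebra_filt_nat m) (@filt_nat_measurable m)).
- by apply/measurable_funTS/measurable_EFinP/martingale_measurable.
- by apply: filterS (ce m n mn) => w /= -> _.
Qed.

Definition transform_increment m w : R := (\1_(B m) w * mdiff f m w)%R.

Definition transform n w : R := (\sum_(m < n.+1) transform_increment m w)%R.

Lemma measurable_B n : measurable (B n).
Proof. exact: (past_measurable (GB n)). Qed.

Lemma measurable_transform_increment m : measurable_fun setT (transform_increment m).
Proof.
apply: measurable_funM; first exact/measurable_indic/measurable_B.
exact/measurable_mdiff/martingale_measurable.
Qed.

Lemma measurable_wrt_mdiff n : measurable_wrt (F n) (mdiff f n).
Proof.
have sF := sigma_algebra_filt_nat n.
case: n sF => [|n] sF /=; first exact: martingale_adapted.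
apply/(measurable_wrtP sF)/measurable_funB; apply/(measurable_wrtP sF).
  exact: martingale_adapted.
move=> A mA; case: Ffilt => _ _ + _; move/(_ n n.+1 (leqnSn n)); apply.
exact: martingale_adapted.
Qed.

Lemma measurable_wrt_transform_increment n m : (m <= n)%N ->
  measurable_wrt (F n) (transform_increment m).
Proof.
move=> mn; have sF := sigma_algebra_filt_nat n.
have Fmn : F m `<=` F n by case: Ffilt => _ _ + _; apply.
apply/(measurable_wrtP sF)/measurable_funM; last first.
  by apply/(measurable_wrtP sF) => A /measurable_wrt_mdiff/Fmn.
by apply/measurable_indic/(measurable_TG sF)/Fmn/past_sub_filt/GB.
Qed.

Lemma measurable_wrt_transform n : measurable_wrt (F n) (transform n).
Proof.
have sF := sigma_algebra_filt_nat n.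
apply/(measurable_wrtP sF)/measurable_sum => i.
by apply/(measurable_wrtP sF)/measurable_wrt_transform_increment; rewrite -ltnS.
Qed.

Lemma measurable_transform n : measurable_fun setT (transform n).
Proof. exact: (measurable_wrt_fun (@filt_nat_measurable n) (@measurable_wrt_transform n)). Qed.

Lemma transformS n w : transform n.+1 w = (transform n w + transform_increment n.+1 w)%R.
Proof. by rewrite /transform big_ord_recr. Qed.

Lemma integrable_mdiff n : P.-integrable setT (EFin \o mdiff f n).
Proof.
case: n => [|n] /=; first exact: martingale_integrable.
apply: (integrableB measurableT (martingale_integrable n.+1) (martingale_integrable n)).
Qed.

Lemma integrable_transform_increment m : P.-integrable setT (EFin \o transform_increment m).
Proof.
apply: le_integrable (integrable_mdiff m) => //.
  exact/measurable_EFinP/measurable_transform_increment.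
move=> w _; rewrite /= lee_fin /transform_increment normrM indicE.
by case: (w \in B m); rewrite ?normr1 ?mul1r ?normr0 ?mul0r.
Qed.

Lemma integrable_transform n : P.-integrable setT (EFin \o transform n).
Proof.
elim: n => [|n IH].
  apply: eq_integrable (integrable_transform_increment 0) => // w _ /=.
  by rewrite /transform big_ord1.
apply: eq_integrable (integrableD measurableT IH (integrable_transform_increment n.+1)) => // w _ /=.
by rewrite transformS.
Qed.

(** As B is predictable, A and B (n+1) both lie in F n, and the martingale property applies on their
    intersection. *)
Lemma integral_transform_increment_eq0 n A : F n A ->
  \int[P]_(w in A) (transform_increment n.+1 w)%:E = 0.
Proof.
move=> FA; have FB : F n (B n.+1) by rewrite -past_filtS.
have FAB : F n (A `&` B n.+1) := sub_setI (sigma_algebra_filt_nat n) FA FB.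
have mAB := filt_nat_measurable FAB.
under eq_integral do rewrite /transform_increment mulrC EFinM.
rewrite -integral_indic_mul.
have := @integralB_EFin _ _ _ P _ (f n.+1) (f n) mAB
  (integrableS measurableT mAB (@subsetT _ _) (martingale_integrable n.+1))
  (integrableS measurableT mAB (@subsetT _ _) (martingale_integrable n)).
move=> /= ->; rewrite (integral_martingale (leqnSn n) FAB) subee//.
apply: integrable_fin_num => //.
exact: (integrableS measurableT mAB (@subsetT _ _) (martingale_integrable n)).
Qed.

Lemma integral_transform n N A : (n <= N)%N -> F n A ->
  \int[P]_(w in A) (transform N w)%:E = \int[P]_(w in A) (transform n w)%:E.
Proof.
move=> + FA; elim: N => [|N IH]; first by rewrite leqn0 => /eqP ->.
rewrite leq_eqVlt => /predU1P[->//|]; rewrite ltnS => nN.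
have mA := filt_nat_measurable FA.
under eq_integral do rewrite transformS.
rewrite integralD_EFin//.
- rewrite IH//= integral_transform_increment_eq0 ?adde0//.
  by case: Ffilt => _ _ + _; move/(_ n N nN); apply.
- exact: (integrableS measurableT mA (@subsetT _ _) (integrable_transform N)).
- exact: (integrableS measurableT mA (@subsetT _ _) (integrable_transform_increment N.+1)).
Qed.

Lemma integral_transform_increment2 m : \int[P]_w (transform_increment m w ^+ 2)%:E =
  \int[P]_w ((\1_(B m) w)%:E * cond_square f m w).
Proof.
under [RHS]eq_integral do rewrite muleC.
rewrite -integral_indic_mul setTI.
have [_ _ ->] := cond_squareP martingale_measurable m; last exact: GB.
rewrite -{1}(setTI (B m)) integral_indic_mul.
apply: eq_integral => w _; rewrite -EFinM /transform_increment exprMn mulrC real_normK ?num_real//.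
by congr ((_ * _)%:E); rewrite indicE; case: (w \in B m); rewrite ?expr1n ?expr0n.
Qed.

Lemma integral_transform_increment2_ge0 m : 0 <= \int[P]_w (transform_increment m w ^+ 2)%:E.
Proof. by apply: integral_ge0 => w _; rewrite lee_fin sqr_ge0. Qed.

Context (K : R).
Hypothesis BK : forall w, \sum_(0 <= n <oo) (\1_(B n) w)%:E * cond_square f n w <= K%:E.

Lemma sum_integral_transform_increment2 :
  \sum_(0 <= m <oo) \int[P]_w (transform_increment m w ^+ 2)%:E <= K%:E.
Proof.
under eq_eseriesr do rewrite integral_transform_increment2.
have t0 n w : 0 <= (\1_(B n) w)%:E * cond_square f n w.
  by rewrite mule_ge0 ?lee_fin// (cond_square_ge0 martingale_measurable).
have mt n : measurable_fun setT (fun w => (\1_(B n) w)%:E * cond_square f n w).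
  apply/emeasurable_funM; first exact/measurable_EFinP/measurable_indic/measurable_B.
  exact: (measurable_cond_square martingale_measurable).
rewrite -integral_nneseries//.
apply: (@le_trans _ _ (\int[P]_w (cst K%:E w))).
  apply: ge0_le_integral => //.
  - by move=> w _; apply: nneseries_ge0.
  - by apply: ge0_emeasurable_sum.
by rewrite integral_cst// [X in _ * X](probability_setT P) mule1.
Qed.

Lemma integral_transform_increment2_lty m : \int[P]_w (transform_increment m w ^+ 2)%:E < +oo.
Proof.
apply: le_lt_trans (ltry K); apply: le_trans sum_integral_transform_increment2.
have := @nneseries_lim_ge _ (fun m => \int[P]_w (transform_increment m w ^+ 2)%:E) xpredT 0 m.+1
  (fun n _ _ => integral_transform_increment2_ge0 n).
apply: le_trans; rewrite big_nat_recr//= leeDr//.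
by apply: sume_ge0 => n _; exact: integral_transform_increment2_ge0.
Qed.

(* f itself need not be square integrable; only the transformed increments are. *)
Lemma integral_transform_diff2 n N : (n <= N)%N ->
  \int[P]_w ((transform N w - transform n w) ^+ 2)%:E =
  \sum_(n.+1 <= i < N.+1) \int[P]_w (transform_increment i w ^+ 2)%:E.
Proof.
elim: N => [|N IH].
  rewrite leqn0 => /eqP ->; rewrite big_geq//.
  under eq_integral do rewrite subrr expr0n.
  by rewrite integral0.
rewrite leq_eqVlt => /predU1P[->|].
  rewrite big_geq//; under eq_integral do rewrite subrr expr0n.
  by rewrite integral0.
rewrite ltnS => nN; rewrite big_nat_recr//= -IH//.
pose D w := (transform N w - transform n w)%R.
have mD : measurable_wrt (F N) D.
  have sF := sigma_algebra_filt_nat N.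
  apply/(measurable_wrtP sF)/measurable_funB; apply/(measurable_wrtP sF).
    exact: measurable_wrt_transform.
  move=> A mA; case: Ffilt => _ _ + _; move/(_ n N nN); apply.
  exact: measurable_wrt_transform.
have mD' := measurable_wrt_fun (@filt_nat_measurable N) mD.
have mt := @measurable_transform_increment N.+1.
have iD2 : P.-integrable setT (EFin \o (fun w => D w ^+ 2)%R).
  apply/integrableP; split; first exact/measurable_EFinP/measurable_funX.
  under eq_integral do rewrite gee0_abs ?lee_fin ?sqr_ge0//.
  rewrite IH//; apply: lte_sum_pinfty => i _; exact: integral_transform_increment2_lty.
have it2 : P.-integrable setT (EFin \o (fun w => transform_increment N.+1 w ^+ 2)%R).
  apply/integrableP; split; first exact/measurable_EFinP/measurable_funX.
  under eq_integral do rewrite gee0_abs ?lee_fin ?sqr_ge0//.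
  exact: integral_transform_increment2_lty.
have iDt : P.-integrable setT (fun w => (D w * transform_increment N.+1 w)%:E).
  apply: le_integrable (integrableD measurableT iD2 it2) => //.
    exact/measurable_EFinP/measurable_funM.
  move=> w _ /=; rewrite lee_fin normrM [leRHS]ger0_norm ?addr_ge0 ?sqr_ge0//.
  rewrite -(real_normK (num_real (D w))) -(real_normK (num_real (transform_increment _ w))).
  have := sqr_ge0 (`|D w| - `|transform_increment N.+1 w|)%R.
  have := mulr_ge0 (normr_ge0 (D w)) (normr_ge0 (transform_increment N.+1 w)).
  move: `|D w|%R `|transform_increment N.+1 w|%R => x y xy; rewrite sqrrB mulr2n; lra.
have Dt0 : \int[P]_w (D w * transform_increment N.+1 w)%:E = 0.
  apply: (integral_mul_eq0 (sigma_algebra_filt_nat N) (@filt_nat_measurable N)) => //.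
  by move=> A; exact: integral_transform_increment_eq0.
transitivity (\int[P]_w ((EFin \o (fun w => D w ^+ 2)%R) w +
   (2%:E * (D w * transform_increment N.+1 w)%:E +
    (EFin \o (fun w => transform_increment N.+1 w ^+ 2)%R) w))).
  by apply: eq_integral => w _; rewrite transformS /= -EFinM -!EFinD /D; congr EFin; ring.
rewrite integralD//; last first.
  by apply: (integrableD measurableT _ it2) => //; exact: integrableZl.
rewrite integralD//; last exact: integrableZl.
by rewrite integralZl// Dt0 mule0 add0e.
Qed.

(** An atom has to be an integrable function and not just a martingale. The L^2 tails are small, so
    a subsequence has summable L^1 increments, and its limit is the required terminal value. *)
Lemma transform_closed : exists a : T -> R, P.-integrable setT (EFin \o a) /\
  forall n A, F n A -> \int[P]_(w in A) (a w)%:E = \int[P]_(w in A) (transform n w)%:E.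
Proof.
have tail (e : R) : (0 < e)%R -> exists n0, forall n N, (n0 <= n)%N -> (n <= N)%N ->
    \int[P]_w ((transform N w - transform n w) ^+ 2)%:E <= e%:E.
  move=> e0.
  have := @nneseries_tail_cvg _ (fun m => \int[P]_w (transform_increment m w ^+ 2)%:E) xpredT
    (le_lt_trans sum_integral_transform_increment2 (ltry K))
    (fun n _ => integral_transform_increment2_ge0 n).
  have nb : nbhs (0 : \bar R) [set x | x <= e%:E].
    have : nbhs (0 : \bar R) [set x | x < e%:E] by exact: (@nbhs_open_ereal_lt R 0%R (fun=> e)).
    by apply: filterS => x /ltW.
  move=> /(_ _ nb)[n0 _ Hn0]; exists n0 => n N n0n nN.
  rewrite integral_transform_diff2//; apply: le_trans (Hn0 n.+1 _); last by rewrite /= (leq_trans n0n).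
  by apply: nneseries_lim_ge => i _ _; exact: integral_transform_increment2_ge0.
pose c k : R := (1 / (2 ^ k.+1)%:R)%R.
have c0 k : (0 < c k)%R by rewrite divr_gt0// ltr0n expn_gt0.
have /choice[N0 HN0] k : exists n0, forall n N, (n0 <= n)%N -> (n <= N)%N ->
    \int[P]_w ((transform N w - transform n w) ^+ 2)%:E <= (c k ^+ 2)%:E.
  by apply: tail; rewrite exprn_gt0.
(* Summing the thresholds makes the indices nondecreasing, with nn k at least N0 k; adding k sends
   them to infinity. *)
pose nn k := (\sum_(i < k.+1) N0 i + k)%N.
have nnS k : (nn k <= nn k.+1)%N.
  rewrite /nn [in leqRHS]big_ord_recr/= -addnA leq_add2l; lia.
have nnN k : (N0 k <= nn k)%N by rewrite /nn big_ord_recr/= addnAC leq_addl.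
have nnk k : (k <= nn k)%N by rewrite /nn leq_addl.
have [] := @integrable_fast_cauchy_limit _ T R P (fun k => transform (nn k)).
- by move=> k; exact: measurable_transform.
- exact: integrable_transform.
- move=> k; set Dk := fun w => (transform (nn k.+1) w - transform (nn k) w)%R.
  have mDk : measurable_fun setT Dk by apply: measurable_funB; exact: measurable_transform.
  (* From L^2 to L^1 by |D| <= c / 2 + D^2 / (2c): with E D^2 <= c^2 the right-hand side has
     expectation at most c. *)
  apply: (@le_trans _ _ (\int[P]_w ((c k / 2)%:E + ((2 * c k)^-1)%:E * (Dk w ^+ 2)%:E))).
    apply: ge0_le_integral => //.
    - exact/measurable_EFinP/measurableT_comp.
    - apply: emeasurable_funD; first exact: measurable_cst.
      by apply/emeasurable_funM; [exact: measurable_cst|exact/measurable_EFinP/measurable_funX].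
    move=> w _; rewrite -EFinM -EFinD lee_fin -/(Dk w).
    rewrite -(real_normK (num_real (Dk w))).
    have -> : (c k / 2 + (2 * c k)^-1 * `|Dk w| ^+ 2 =
       `|Dk w| + (2 * c k)^-1 * (`|Dk w| - c k) ^+ 2)%R by field; rewrite gt_eqF.
    by rewrite lerDl mulr_ge0 ?sqr_ge0// invr_ge0 mulr_ge0// ltW.
  rewrite ge0_integralD//; first last.
  - by apply/emeasurable_funM; [exact: measurable_cst|exact/measurable_EFinP/measurable_funX].
  - by move=> w _; rewrite -EFinM lee_fin mulr_ge0 ?sqr_ge0// invr_ge0 mulr_ge0// ltW.
  - by move=> w _; rewrite lee_fin divr_ge0// ltW.
  rewrite integral_cst// [X in _ * X + _](probability_setT P) mule1.
  rewrite ge0_integralZl//; first last.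
  - by rewrite lee_fin invr_ge0 mulr_ge0// ltW.
  - by move=> w _; rewrite lee_fin sqr_ge0.
  - exact/measurable_EFinP/measurable_funX.
  apply: (@le_trans _ _ ((c k / 2)%:E + ((2 * c k)^-1)%:E * (c k ^+ 2)%:E)).
    rewrite leeD2l// lee_wpmul2l ?lee_fin ?invr_ge0 ?mulr_ge0 ?(ltW (c0 k))//.
    exact: (HN0 k (nn k) (nn k.+1)).
  rewrite -EFinM -EFinD lee_fin le_eqVlt; apply/orP; left; apply/eqP.
  by rewrite -/(c k); field; rewrite gt_eqF.
move=> a [ia acvg]; exists a; split => // n A FA.
have /acvg cA := filt_nat_measurable FA.
(* By the martingale property of the transform these integrals no longer change once nn k >= n, so
   the limit a inherits their value. *)
have cst_cvg : \int[P]_(w in A) (transform (nn k) w)%:E @[k --> \oo] -->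
    \int[P]_(w in A) (transform n w)%:E.
  apply: cvg_near_cst; exists n => // k /= nk.
  exact: (integral_transform (leq_trans nk (nnk k)) FA).
by rewrite -(cvg_lim (@ereal_hausdorff _) cA) (cvg_lim (@ereal_hausdorff _) cst_cvg).
Qed.

End martingale_transform.

End filtrations.

(** * The decomposition *)

Lemma ae_forall_int d (T : measurableType d) (R : realType)
    (mu : {measure set T -> \bar R}) (A : int -> T -> Prop) :
  (forall k, {ae mu, forall w, A k w}) -> {ae mu, forall w, forall k, A k w}.
Proof.
move=> Ak; have := ae_foralln (fun n => Ak (Posz n)); have := ae_foralln (fun n => Ak (Negz n)).
by apply: filterS2 => w neg pos [n|n].
Qed.

Lemma lt_poweR_half (R : realType) (c : R) (x : \bar R) : (0 < c)%R -> (0 <= x)%E ->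
  (c%:E < x `^ 2^-1)%E = ((c ^+ 2)%:E < x)%E.
Proof.
move=> c0; case: x => [r| |]// r0; last by rewrite poweRyr ?invr_eq0// !ltry.
rewrite lee_fin in r0; rewrite poweR_EFin powR12_sqrt// !lte_fin.
rewrite -[X in _ = (_ < X)%R](sqr_sqrtr r0).
by rewrite ltr_pXn2r// nnegrE ?sqrtr_ge0// ltW.
Qed.

Section decomposition.
Context d (T : measurableType d) (R : realType) (P : probability T R).
Context (F : nat -> set (set T)) (Ffilt : is_filtration F).
Context (f : nat -> T -> R) (fM : is_martingale P F f).
Local Open Scope ereal_scope.
Local Notation v := (cond_square P F f).
Local Notation s := (csquare P F f).
Local Notation mf := (martingale_measurable Ffilt fM).

(** The sum includes the term of index n, which is measurable at time n - 1; bounding this sum on a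
    band thus bounds the last term kept as well. *)
Definition partial_square n w : \bar R := \sum_(m < n.+1) v m w.

(* The event that tau_k < n, which is known at time n - 1. *)
Definition past_level (k : int) (n : nat) : set T :=
  [set w | (((2 : R) ^ k) ^+ 2)%:E < partial_square n w].

Lemma cond_square_martingale_ge0 n w : 0 <= v n w.
Proof. exact: (cond_square_ge0 P Ffilt mf). Qed.

Lemma partial_squareS n w : partial_square n.+1 w = partial_square n w + v n.+1 w.
Proof. by rewrite /partial_square big_ord_recr. Qed.

Lemma partial_square_ge0 n w : 0 <= partial_square n w.
Proof. by apply: sume_ge0 => m _; exact: cond_square_martingale_ge0. Qed.

Lemma le_partial_square m n w : (m <= n)%N -> partial_square m w <= partial_square n w.
Proof.
move=> /subnK <-; elim: (n - m)%N => [|k IH]; first by rewrite add0n.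
by rewrite addSn partial_squareS (le_trans IH)// leeDl// cond_square_martingale_ge0.
Qed.

Lemma partial_square_le n w : partial_square n w <= \sum_(0 <= m <oo) v m w.
Proof.
rewrite /partial_square -(big_mkord xpredT (fun m => v m w)).
by apply: nneseries_lim_ge => m _ _; exact: cond_square_martingale_ge0.
Qed.

Lemma measurable_partial_square n : measurable_fun setT
  (partial_square n : g_sigma_algebraType (past_filt F n) -> \bar R).
Proof.
have sG := sigma_algebra_past Ffilt n.
apply: emeasurable_sum => m; apply/(measurable_wrtP sG) => A mA.
have mn : (m <= n)%N by rewrite -ltnS.
apply: (le_past Ffilt mn).
exact: (measurable_wrt_cond_square P Ffilt mf).
Qed.

Lemma past_level_filt k n : past_filt F n (past_level k n).
Proof.
apply/(measurable_TG (sigma_algebra_past Ffilt n)); rewrite -[X in measurable X]setTI.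
apply: (@emeasurable_fun_o_infty _ (g_sigma_algebraType (past_filt F n)) R setT) => //.
exact: measurable_partial_square.
Qed.

Lemma le_past_level k m n : (m <= n)%N -> past_level k m `<=` past_level k n.
Proof. by move=> mn w /= /lt_le_trans; apply; exact: le_partial_square. Qed.

Lemma ge_past_level k l n : (k <= l)%R -> past_level l n `<=` past_level k n.
Proof.
move=> kl w /=; apply: le_lt_trans; rewrite lee_fin lerXn2r ?nnegrE ?exprz_ge0//.
by rewrite ler_weXz2l// ler1n.
Qed.

Lemma csquare_ge0 w : 0 <= s w. Proof. exact: poweR_ge0. Qed.

Lemma measurable_csquare_martingale : measurable_fun setT s.
Proof. exact: (measurable_csquare P Ffilt mf). Qed.

(** An increasing limit exceeds a number exactly when one of its terms does; this relies on the
    strict inequalities in [level] and [past_level]. *)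
Lemma levelE k w : level s k w <-> exists n, past_level k n w.
Proof.
have sum0 : 0 <= \sum_(0 <= m <oo) v m w by apply: nneseries_ge0 => n _ _; exact: cond_square_martingale_ge0.
rewrite /level /= csquareE lt_poweR_half ?exprz_gt0//; split=> [lw|[n]]; last first.
  by move=> /lt_le_trans; apply; exact: partial_square_le.
apply: contrapT => nw; move: lw; apply/negP; rewrite -leNgt.
apply: lime_le; first by apply: is_cvg_nneseries => n _ _; exact: cond_square_martingale_ge0.
apply: nearW => n; case: n => [|n]; first by rewrite big_geq// lee_fin sqr_ge0.
rewrite big_mkord leNgt; apply/negP => kn; apply: nw; by exists n.
Qed.

(* The largest partial sum not exceeding c bounds the sum over all these n. *)
Lemma stopped_square_le (B : nat -> set T) (c : R) w : (0 <= c)%R ->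
  (forall n, B n w -> partial_square n w <= c%:E) ->
  \sum_(0 <= n <oo) (\1_(B n) w)%:E * v n w <= c%:E.
Proof.
move=> c0 Bc.
have t0 n : 0 <= (\1_(B n) w)%:E * v n w by rewrite mule_ge0 ?lee_fin// cond_square_martingale_ge0.
have part n : \sum_(0 <= m < n.+1) (\1_(B m) w)%:E * v m w <= c%:E /\
    \sum_(0 <= m < n.+1) (\1_(B m) w)%:E * v m w <= partial_square n w.
  elim: n => [|n [IH1 IH2]].
    rewrite big_nat1 indicE /partial_square big_ord1.
    case: (boolP (w \in B 0%N)) => [/set_mem/Bc|_]; rewrite ?mul1e ?mul0e ?lee_fin ?cond_square_martingale_ge0//.
    by rewrite /partial_square big_ord1.
  rewrite big_nat_recr//= partial_squareS indicE.
  case: (boolP (w \in B n.+1)) => [/set_mem/Bc Sc|_]; rewrite ?mul1e ?mul0e ?adde0.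
    have le : \sum_(0 <= m < n.+1) (\1_(B m) w)%:E * v m w + v n.+1 w <=
       partial_square n.+1 w by rewrite partial_squareS leeD2r.
    by split; [exact: le_trans Sc|rewrite -partial_squareS].
  by split => //; rewrite (le_trans IH2)// leeDl// cond_square_martingale_ge0.
apply: lime_le; first by apply: is_cvg_nneseries => n _ _; exact: t0.
apply: nearW => n; case: n => [|n]; first by rewrite big_geq// lee_fin.
by case: (part n).
Qed.

(* The event that tau_k < n <= tau_(k+1). *)
Definition band (k : int) (n : nat) : set T :=
  past_level k n `\` past_level (k + 1)%R n.

Lemma past_filt_setD n A B : past_filt F n A -> past_filt F n B -> past_filt F n (A `\` B).
Proof.
have sG := sigma_algebra_past Ffilt n.
by move=> /(measurable_TG sG) mA /(measurable_TG sG) mB; apply/(measurable_TG sG)/measurableD.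
Qed.

Lemma band_filt k n : past_filt F n (band k n).
Proof. by apply: past_filt_setD; exact: past_level_filt. Qed.

Lemma band_square_le k w :
  \sum_(0 <= n <oo) (\1_(band k n) w)%:E * v n w <= (((2 : R) ^ (k + 1)%R) ^+ 2)%:E.
Proof.
apply: stopped_square_le => [|n [_ nk]]; first exact: sqr_ge0.
by rewrite leNgt; apply/negP.
Qed.

(** The shift by one matches [past_level k n] being the event that tau_k < n; the value -1 occurs
    when the level is already passed at n = 0. *)
Definition exit_time (k : int) (w : T) : \bar int :=
  if pselect (exists n, `[< past_level k n w >]) is left h
  then ((ex_minn h)%:Z - 1)%:E else +oo.

Lemma exit_time_le k w (l : nat) :
  (exit_time k w <= (l%:Z - 1)%:E) <-> past_level k l w.
Proof.
rewrite /exit_time; case: pselect => [h|nh]; last first.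
  rewrite leye_eq; split => // kl; exfalso; apply: nh; exists l; exact/asboolP.
case: ex_minnP => n /asboolP kn nmin; rewrite lee_fin lerD2r lez_nat.
split=> [nl|kl]; first exact: le_past_level nl w kn.
by apply: nmin; exact/asboolP.
Qed.

Lemma exit_time_stopping k : is_stopping_time F (exit_time k).
Proof.
split=> [w|l l1].
  rewrite /exit_time; case: pselect => [h|nh]; last by rewrite leey.
  by rewrite lee_fin lerBrDr addrC subrr.
have [n ln] : exists n : nat, l = (n%:Z - 1)%R.
  by exists `|(l + 1)%R|%N; rewrite gez0_abs ?addrK// -lerBlDr sub0r.
rewrite (_ : [set w | _] = past_level k n).
  by rewrite ln; exact: past_level_filt.
by apply/seteqP; split => w /=; rewrite ln exit_time_le.
Qed.

(** This identity is the reason for the coefficients: an atom is normalised by the norm of {tau <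
    oo}, which here is a level set of s. *)
Lemma exit_time_lty k : [set w | exit_time k w < +oo] = level s k.
Proof.
apply/seteqP; split => w.
  rewrite /= /exit_time; case: pselect => // -[n /asboolP kn] _.
  by apply/levelE; exists n.
move=> /levelE[n kn] /=; apply: (@le_lt_trans _ _ (n%:Z - 1)%:E); last exact: ltry.
exact/exit_time_le.
Qed.

Lemma exit_time_ge k n m w : n%:Z%:E <= exit_time k w -> (m <= n)%N -> ~ past_level k m w.
Proof.
move=> nt mn /exit_time_le tm.
by have := le_trans nt tm; rewrite lee_fin; lia.
Qed.

Lemma sqr_poweR_half (c : R) : (0 <= c)%R -> ((c ^+ 2)%:E `^ 2^-1 = c%:E :> \bar R).
Proof. by move=> c0; rewrite poweR_EFin powR12_sqrt ?sqr_ge0// sqrtr_sqr ger0_norm. Qed.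

Lemma transform_past_level k n w : ~ level s k w -> transform f (band k) n w = 0%R.
Proof.
move=> kw; rewrite /transform big1// => m _; rewrite /transform_increment indicE memNset ?mul0r//.
by move=> [km _]; apply: kw; apply/levelE; exists m.
Qed.

(** The sets [past_level k n] decrease in k and the bands are their successive differences, so the
    sum telescopes. *)
Lemma sum_indic_band (j m n : nat) w :
  (\sum_(i < (j + m).+1) \1_(band (i%:Z - j%:Z)%R n) w =
   \1_(past_level (- j%:Z)%R n `\` past_level m.+1%:Z n) w :> R)%R.
Proof.
pose u (i : nat) : R := (- \1_(past_level (i%:Z - j%:Z)%R n) w)%R.
have indD k l : (k <= l)%R -> (\1_(past_level k n `\` past_level l n) w =
    \1_(past_level k n) w - \1_(past_level l n) w :> R)%R.
  move=> kl; rewrite !indicE.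
  have [lw|lw] := pselect (past_level l n w).
    have kw := ge_past_level kl lw.
    by rewrite (mem_set kw) (mem_set lw) subrr memNset// => -[].
  rewrite (memNset lw) subr0.
  have [kw|kw] := pselect (past_level k n w); first by rewrite !mem_set.
  by rewrite !memNset// => -[].
transitivity (\sum_(0 <= i < (j + m).+1) (u i.+1 - u i))%R.
  rewrite big_mkord; apply: eq_bigr => i _; rewrite indD ?lerDl//.
  rewrite /u opprK addrC; congr (- \1_(past_level _ n) w + _)%R.
  by rewrite intS; ring.
rewrite telescope_sumr// /u opprK addrC sub0r indD; last by lia.
congr (_ - \1_(past_level _ n) w)%R; lia.
Qed.

(** The union of the bands from - j to m. Through it each partial sum of the decomposition is again
    a transform of f by a predictable set. *)
Definition wide_band (j m n : nat) : set T :=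
  past_level (- j%:Z)%R n `\` past_level m.+1%:Z n.

Lemma wide_band_filt j m n : past_filt F n (wide_band j m n).
Proof. by apply: past_filt_setD; exact: past_level_filt. Qed.

Lemma zsum_transform (j m n : nat) w :
  zsum (fun k => transform f (band k) n w) j m = transform f (wide_band j m) n w.
Proof.
rewrite /zsum /transform exchange_big/=; apply: eq_bigr => q _.
by rewrite /transform_increment -mulr_suml sum_indic_band.
Qed.

(** All levels 2^k are positive, so no band meets the set where the partial square is 0. That set is
    known at time n - 1, and there |d_n f|^2 has the same integral as its conditional expectation,
    namely 0. *)
Lemma mdiff_eq0 n : {ae P, forall w, partial_square n w = 0 -> mdiff f n w = 0%R}.
Proof.
have GZ : past_filt F n (~` [set w | 0 < partial_square n w]).
  have sG := sigma_algebra_past Ffilt n.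
  apply/(measurable_TG sG)/measurableC; rewrite -[X in measurable X]setTI.
  apply: (@emeasurable_fun_o_infty _ (g_sigma_algebraType (past_filt F n)) R setT) => //.
  exact: measurable_partial_square.
have [_ _ vE] := cond_squareP P Ffilt mf n.
have mZ := past_measurable Ffilt GZ.
have := vE _ GZ; rewrite integral0_eq; last first.
  move=> w /= nw; apply/eqP; rewrite eq_le cond_square_martingale_ge0 andbT.
  apply: (@le_trans _ _ (partial_square n w)); last by rewrite leNgt; exact/negP.
  rewrite /partial_square (bigD1 ord_max)//= leeDl//.
  by apply: sume_ge0 => i _; exact: cond_square_martingale_ge0.
move=> /esym.
have /measurable_EFinP/(measurable_funTS (D := ~` [set w | 0 < partial_square n w])) mE :=
  measurable_mdiff2 mf n.
under eq_integral do rewrite -[X in X%:E]ger0_norm ?exprn_ge0// -abse_EFin.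
move=> /(ae_eq_integral_abs P mZ mE).
apply: filterS => w /= h w0; have := h _.
rewrite w0 ltxx => /(_ (fun x => notF x)) [] /eqP.
by rewrite sqrf_eq0 normr_eq0 => /eqP.
Qed.

(** * The atoms and their normalisation *)

Section atoms.
Context (p : T -> R) (pexp : is_exponent P p).
Hypothesis normf : Hs_norm P F p f < +oo.

Lemma csquare_lty_ae : {ae P, forall w, s w < +oo}.
Proof.
have := vnorm_lty_ae pexp measurable_csquare_martingale normf.
by apply: filterS => w; rewrite gee0_abs// csquare_ge0.
Qed.

Local Notation theta := (level_coef P p s).
Local Notation N k := (fine (vnorm P p (EFin \o \1_(level s k)))).

(** The atom is the terminal value of the transform, divided by the coefficient. If the coefficient
    is 0, so is its inverse, and the atom is the zero function. *)
Lemma atom_exists k : exists a : T -> R, P.-integrable setT (EFin \o a) /\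
  forall n, {ae P, forall w, mart_of P F a n w = (theta k)^-1 * transform f (band k) n w}%R.
Proof.
have [a [ia aE]] := transform_closed Ffilt fM (band_filt k) (band_square_le k).
have ica : P.-integrable setT (EFin \o (fun w => (theta k)^-1 * a w)%R).
  exact: (integrableZl measurableT _ ia).
exists (fun w => (theta k)^-1 * a w)%R; split => // n.
have it := integrable_transform Ffilt fM (band_filt k) n.
have mt := @measurable_wrt_transform _ _ _ _ _ Ffilt _ fM _ (band_filt k) n.
apply: (condexpR_unique (sigma_algebra_filt_nat Ffilt n) (@filt_nat_measurable _ _ _ Ffilt n)) => //.
- exact: (integrableZl measurableT _ it).
- apply/(measurable_wrtP (sigma_algebra_filt_nat Ffilt n))/measurable_funM => //.
  exact/(measurable_wrtP (sigma_algebra_filt_nat Ffilt n)).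
- move=> A FA; have mA := filt_nat_measurable Ffilt FA.
  under eq_integral do rewrite EFinM.
  under [RHS]eq_integral do rewrite EFinM.
  rewrite !integralZl//.
  + by rewrite (aE n A).
  + exact: (integrableS measurableT mA (@subsetT _ _) ia).
  + exact: (integrableS measurableT mA (@subsetT _ _) it).
Qed.

(** Outside the level set all bands are missed, and on it 2^(k+1) / theta_k = 1 / N k. The atom
    property uses only the size of this bound, while the norm bound by 1 also needs its support. *)
Lemma csquare_atom k (a : T -> R) : P.-integrable setT (EFin \o a) ->
  (forall n, {ae P, forall w, mart_of P F a n w = (theta k)^-1 * transform f (band k) n w}%R) ->
  {ae P, forall w, csquare P F (mart_of P F a) w <= ((N k)^-1 * \1_(level s k) w)%:E}.
Proof.
move=> ia aE.
have ma n : measurable_fun setT (mart_of P F a n).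
  apply: (measurable_wrt_fun (@filt_nat_measurable _ _ _ Ffilt n)).
  exact: (measurable_wrt_condexpR (sigma_algebra_filt_nat Ffilt n) (@filt_nat_measurable _ _ _ Ffilt n)).
have th0 : (0 <= (theta k)^-1)%R by rewrite invr_ge0 level_coef_ge0.
have diffE n : {ae P, forall w, mdiff (mart_of P F a) n w =
    (theta k)^-1 * (\1_(band k n) w * mdiff f n w)}%R.
  case: n => [|n] /=.
    by apply: filterS (aE 0%N) => w ->; rewrite /transform big_ord1.
  apply: filterS2 (aE n) (aE n.+1) => w -> ->.
  by rewrite transformS mulrDr addrC addKr.
apply: filterS (csquare_indic Ffilt mf ma (band_filt k) th0 diffE) => w ->.
have [kw|kw] := pselect (level s k w); last first.
  rewrite indicE (memNset kw) mulr0 eseries0 ?poweR0r ?mule0 ?invr_neq0//.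
  move=> n _ _; rewrite indicE memNset ?mul0e// => -[kn _].
  by apply: kw; apply/levelE; exists n.
rewrite indicE (mem_set kw) mulr1.
apply: (@le_trans _ _ ((theta k)^-1%:E * ((2 : R) ^ (k + 1)%R)%:E)).
  rewrite lee_wpmul2l// -[leRHS]sqr_poweR_half ?exprz_ge0//.
  apply: gt0_ler_poweR (band_square_le k w); rewrite ?in_itv/= ?leey ?andbT ?invr_ge0//.
    by apply: nneseries_ge0 => n _ _; rewrite mule_ge0 ?lee_fin// cond_square_martingale_ge0.
  by rewrite lee_fin sqr_ge0.
rewrite -EFinM lee_fin /level_coef expfzDr// expr1z [(2 * _)%R]mulrC invfM.
by rewrite mulrAC mulVf ?mul1r// mulf_neq0// gt_eqF// exprz_gt0.
Qed.

Lemma atom_is_atom k (a : T -> R) : P.-integrable setT (EFin \o a) ->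
  (forall n, {ae P, forall w, mart_of P F a n w = (theta k)^-1 * transform f (band k) n w}%R) ->
  is_atom1 P F p a.
Proof.
move=> ia aE; split => //; exists (exit_time k); split.
- exact: exit_time_stopping.
- move=> n; apply: filterS (aE n) => w; rewrite /mart_of => -> nt.
  rewrite /transform big1 ?mulr0// => m _; rewrite /transform_increment indicE memNset ?mul0r//.
  by move=> [km _]; apply: (exit_time_ge nt _ km); rewrite -ltnS.
rewrite exit_time_lty unlock /= probability_setT lte01.
have N0 : 0 <= vnorm P p (EFin \o \1_(level s k)) by exact: vnorm_ge0.
apply/ess_supP; apply: filterS (csquare_atom ia aE) => w /= le.
rewrite gee0_abs ?poweR_ge0//.
(* In the extended reals the inverse of a zero norm is +oo, whereas the real inverse in the bound on
   the square function is 0. *)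
have [N_eq0|N_neq0] := eqVneq (N k) 0%R.
  by rewrite level_norm_fin ?N_eq0 ?inve0 ?leey//; exact: measurable_csquare_martingale.
rewrite level_norm_fin//; last exact: measurable_csquare_martingale.
rewrite inver (negbTE N_neq0) (le_trans le)// lee_fin -[leRHS]mulr1 ler_wpM2l ?invr_ge0 ?fine_ge0//.
Qed.

Lemma atom_norm k (a : T -> R) : P.-integrable setT (EFin \o a) ->
  (forall n, {ae P, forall w, mart_of P F a n w = (theta k)^-1 * transform f (band k) n w}%R) ->
  Hs_norm P F p (mart_of P F a) <= 1.
Proof.
move=> ia aE; apply: (vnorm_indic_normalized pexp (measurable_level measurable_csquare_martingale k)).
  apply: (measurable_csquare P Ffilt) => n.
  apply: (measurable_wrt_fun (@filt_nat_measurable _ _ _ Ffilt n)).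
  exact: (measurable_wrt_condexpR (sigma_algebra_filt_nat Ffilt n) (@filt_nat_measurable _ _ _ Ffilt n)).
apply: filterS (csquare_atom ia aE) => w le.
by rewrite gee0_abs ?poweR_ge0.
Qed.

(* If the coefficient is 0, then the norm of the level set is 0, the level set is
   null, and so is the transform. *)
Lemma coef_mulr k n :
  {ae P, forall w,
  theta k * ((theta k)^-1 * transform f (band k) n w) = transform f (band k) n w}%R.
Proof.
have [t0|t0] := eqVneq (theta k) 0%R; last first.
  by apply/nearW => w'; rewrite mulrA mulfV ?mul1r.
have N0 : N k = 0%R.
  move/eqP: t0; rewrite /level_coef !mulf_eq0 (gt_eqF (exprz_gt0 _ _)) ?ltr0n// pnatr_eq0/=.
  by move=> /eqP.
have mk := measurable_level measurable_csquare_martingale k.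
have Pk : P (level s k) = 0.
  apply: (vnorm_indic_eq0 pexp mk).
  by rewrite level_norm_fin ?N0//; exact: measurable_csquare_martingale.
exists (level s k); split => // w' /= nw; apply: contrapT => kw; apply: nw.
by rewrite t0 mul0r transform_past_level.
Qed.

(** A positive finite partial square satisfies 4^(- j) < S <= 4^(m+1) once j and m are large. A zero
    partial square is never captured, but then the increment is 0 as well. *)
Lemma near_indic_wide_band q w : (partial_square q w = 0 -> mdiff f q w = 0%R) -> s w < +oo ->
  \forall jm \near filter_prod \oo \oo,
    (\1_(wide_band jm.1 jm.2 q) w * mdiff f q w = mdiff f q w)%R.
Proof.
move=> d0 soo; have [S0|S0] := eqVneq (partial_square q w) 0.
  by apply: nearW => jm; rewrite d0// mulr0.
have sumoo : \sum_(0 <= n <oo) v n w < +oo.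
  by apply: (@lty_poweRy _ _ 2^-1%R); rewrite ?invr_neq0// -csquareE.
have [r rE] : exists r : R, partial_square q w = r%:E.
  have := le_lt_trans (partial_square_le q w) sumoo; have := partial_square_ge0 q w.
  by case: (partial_square q w) => // r _ _; exists r.
have r0 : (0 < r)%R.
  by rewrite -lte_fin -rE lt_neqAle eq_sym S0 partial_square_ge0.
have exp2_ge1 (n : nat) : (1 <= (2 : R) ^ n%:Z)%R by rewrite -exprnP exprn_ege1 ?ler1n.
have [M Mr] := exp2z_unbounded r; have [J Jr] := exp2z_unbounded r^-1.
exists ([set j | (J < j)%N], [set m | (M <= m)%N]).
  by split; [exists J.+1|exists M].
move=> [j m] [/= Jj Mm]; rewrite indicE mem_set ?mul1r//; split; rewrite /past_level/= rE.
  rewrite lte_fin; apply: (@le_lt_trans _ _ ((2 : R) ^ (- j%:Z)%R)%R).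
    rewrite expr2 -[leRHS]mulr1 ler_wpM2l ?exprz_ge0//.
    by rewrite -invr_expz invf_le1 ?exprz_gt0// exp2_ge1.
  rewrite -invr_expz invf_plt ?posrE ?exprz_gt0//.
  by rewrite (le_lt_trans Jr)// ltr_eXz2l ?ltr1n//; lia.
apply/negP; rewrite -leNgt lee_fin; apply: (le_trans Mr).
apply: (@le_trans _ _ ((2 : R) ^ m.+1%:Z)%R).
  by rewrite ler_weXz2l ?ler1n//; lia.
rewrite expr2 -[leLHS]mulr1 ler_wpM2l ?exprz_ge0//.
Qed.

(** The pointwise convergence is stationary: f_n has finitely many increments, and each is recovered
    exactly from some window on. *)
Lemma near_transform_wide_band n w :
  (forall q, partial_square q w = 0 -> mdiff f q w = 0%R) -> s w < +oo ->
  \forall jm \near filter_prod \oo \oo, transform f (wide_band jm.1 jm.2) n w = f n w.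
Proof.
move=> d0 soo; elim: n => [|n IH].
  apply: filterS (near_indic_wide_band (d0 0%N) soo) => jm jmE.
  by rewrite /transform big_ord1 /transform_increment jmE.
apply: filterS2 IH (near_indic_wide_band (d0 n.+1) soo) => jm IH jmE.
by rewrite transformS IH /transform_increment jmE /= addrC subrK.
Qed.

(** * Convergence of the partial sums *)

Section decomposition_convergence.
Context (a : int -> T -> R) (ia : forall k, P.-integrable setT (EFin \o a k)).
Hypothesis aE : forall k n, {ae P, forall w,
  mart_of P F (a k) n w = (theta k)^-1 * transform f (band k) n w}%R.

(** There are countably many n and k, so one null set serves all partial sums. This uniformity is
    needed before j and m tend to infinity at a fixed point. *)
Lemma partial_sum_mart : {ae P, forall w, forall n j m,
  zsum (fun k => theta k * mart_of P F (a k) n w)%R j m = transform f (wide_band j m) n w}.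
Proof.
have h1 := ae_foralln (fun n => ae_forall_int (aE ^~ n)).
have h2 := ae_foralln (fun n => ae_forall_int (coef_mulr ^~ n)).
apply: filterS2 h1 h2 => w e1 e2 n j m.
rewrite -zsum_transform; apply: eq_bigr => i _.
by rewrite e1 e2.
Qed.

Lemma partial_sum_cvg n : {ae P, forall w,
  zsum (fun k => theta k * mart_of P F (a k) n w)%R jm.1 jm.2
    @[jm --> (\oo, \oo)] --> f n w}.
Proof.
apply: filterS3 partial_sum_mart (ae_foralln mdiff_eq0) csquare_lty_ae => w e d0 soo.
apply: cvg_near_cst; apply: filterS (near_transform_wide_band n d0 soo) => jm <-.
exact: e.
Qed.

Lemma measurable_remainder j m n : measurable_fun setT
  (fun w => f n w - zsum (fun k => theta k * mart_of P F (a k) n w) j m)%R.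
Proof.
apply: measurable_funB; first exact: mf.
apply: measurable_sum => i; apply: measurable_funM => //.
apply: (measurable_wrt_fun (@filt_nat_measurable _ _ _ Ffilt n)).
exact: (measurable_wrt_condexpR (sigma_algebra_filt_nat Ffilt n) (@filt_nat_measurable _ _ _ Ffilt n)).
Qed.

(** The remainder is the transform of f by the complement of the wide band. Where s <= 2^(m+1) the
    upper level is never passed, so only increments with partial square at most 4^(- j) survive;
    elsewhere s itself is a bound. *)
Lemma csquare_remainder_le j m : {ae P, forall w,
  csquare P F (fun n w => f n w -
    zsum (fun k => theta k * mart_of P F (a k) n w) j m)%R w <=
  if s w <= ((2 : R) ^ m.+1%:Z)%:E then ((2 : R) ^ (- j%:Z)%R)%:E else s w}.
Proof.
have Gmid n : past_filt F n (~` wide_band j m n).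
  have sG := sigma_algebra_past Ffilt n.
  by apply/(measurable_TG sG)/measurableC/(measurable_TG sG)/wide_band_filt.
have diffE n : {ae P, forall w, mdiff (fun n w => f n w -
    zsum (fun k => theta k * mart_of P F (a k) n w) j m) n w =
    1 * (\1_(~` wide_band j m n) w * mdiff f n w)}%R.
  apply: filterS partial_sum_mart => w e.
  have indC (A : set T) : (\1_(~` A) w = 1 - \1_A w :> R)%R.
    rewrite !indicE in_setC; case: (w \in A); rewrite /= ?subrr ?subr0//.
  rewrite mul1r indC mulrBl mul1r; case: n => [|n] /=; rewrite !e.
    by rewrite /transform big_ord1.
  by rewrite transformS /transform_increment/=; ring.
apply: filterS (csquare_indic Ffilt mf (measurable_remainder j m) Gmid ler01 diffE) => w ->.
rewrite mul1e.
have half0 : (0 <= 2^-1 :> R)%R by rewrite invr_ge0.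
have sum0 (B : nat -> set T) : 0 <= \sum_(0 <= n <oo) (\1_(B n) w)%:E * v n w.
  by apply: nneseries_ge0 => n _ _; rewrite mule_ge0 ?lee_fin// cond_square_martingale_ge0.
case: ifPn => [sm|_]; last first.
  rewrite csquareE; apply: gt0_ler_poweR; rewrite ?in_itv/= ?leey ?andbT//.
    by apply: nneseries_ge0 => n _ _; exact: cond_square_martingale_ge0.
  apply: lee_nneseries => n _; first by move=> _; rewrite mule_ge0 ?lee_fin// cond_square_martingale_ge0.
  by rewrite -[leRHS]mul1e lee_wpmul2r ?cond_square_martingale_ge0// lee_fin.
rewrite -[leRHS]sqr_poweR_half ?exprz_ge0//.
apply: gt0_ler_poweR; rewrite ?in_itv/= ?leey ?andbT//.
apply: stopped_square_le => [|n nmid]; first exact: sqr_ge0.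
rewrite leNgt; apply/negP => jn; apply: nmid; split => // mn.
move: sm; apply/negP; rewrite -ltNge.
by apply/levelE; exists n.
Qed.

Lemma partial_sum_norm_cvg :
  Hs_norm P F p (fun n w =>
      f n w - zsum (fun k => theta k * mart_of P F (a k) n w) jm.1 jm.2)%R
    @[jm --> (\oo, \oo)] --> 0.
Proof.
move=> A /= [e /= e0 eA].
have e20 : (0 < e / 2)%R by rewrite divr_gt0.
have [J [M JM]] := vnorm_tail pexp measurable_csquare_martingale csquare_ge0 e20 normf.
exists ([set j | (J <= j)%N], [set m | (M <= m)%N]).
  by split; [exists J|exists M].
move=> [j m] [/= Jj Mm].
set X := Hs_norm _ _ _ _.
have X0 : 0 <= X by exact: vnorm_ge0.
have Xe : X <= (e / 2)%:E.
  apply: (JM j m _ Jj Mm (measurable_csquare P Ffilt (measurable_remainder j m))).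
  apply: filterS (csquare_remainder_le j m) => w.
  by rewrite gee0_abs; last exact: poweR_ge0.
case: X X0 Xe => // r; rewrite !lee_fin => r0 re; apply: eA.
rewrite /ball_/= sub0r normrN ger0_norm// (le_lt_trans re)//.
by rewrite ltr_pdivrMr// ltr_pMr// ltr1n.
Qed.

End decomposition_convergence.

End atoms.

End decomposition.

Theorem theorem3p1 (d : measure_display) (T : measurableType d) (R : realType)
    (P : probability T R) (Pcomplete : measure_is_complete P)
    (F : nat -> set (set T)) (Ffilt : is_filtration F)
    (p : T -> R) (pexp : is_exponent P p) :
  exists C : R, 0 < C /\
  forall f : nat -> T -> R, is_martingale P F f -> (Hs_norm P F p f < +oo)%E ->
  exists (a : int -> T -> R) (theta : int -> R),
    (forall k, is_atom1 P F p (a k)) /\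
    (forall k, (Hs_norm P F p (mart_of P F (a k)) <= 1)%E) /\
    (forall k, 0 <= theta k) /\
    (forall n, {ae P, forall w,
       zsum (fun k => theta k * mart_of P F (a k) n w) jm.1 jm.2
         @[jm --> (\oo, \oo)] --> f n w}) /\
    ((C^-1)%:E * (\esum_(k in [set: int]) (theta k `^ pplus P p)%:E)
                   `^ (pplus P p)^-1 <= Hs_norm P F p f)%E /\
    (Hs_norm P F p f <=
      C%:E * (\esum_(k in [set: int]) (theta k `^ pminus P p)%:E)
               `^ (pminus P p)^-1)%E /\
    Hs_norm P F p (fun n w =>
        f n w - zsum (fun k => theta k * mart_of P F (a k) n w) jm.1 jm.2)
      @[jm --> (\oo, \oo)] --> 0%E.
Proof.
(* The lower estimate needs the constant 2c and the upper one only 2; as c >= 1, the choice C = 2c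
   serves both. *)
pose c := level_ratio P p `^ (pplus P p)^-1.
have lr1 : 1 <= level_ratio P p.
  by rewrite /level_ratio invf_ge1 ?level_ratio_gt0 ?(pminus_gt0 pexp)//.
have c1 : 1 <= c.
  rewrite -[leLHS](congr1 (fun f => f (pplus P p)^-1) (@powR1 R)).
  apply: ge0_ler_powR => //; rewrite ?nnegrE ?invr_ge0 ?(ltW (pplus_gt0 pexp))//.
  exact/ltW/level_ratio_gt0/(pminus_gt0 pexp).
have C0 : 0 < 2 * c by rewrite mulr_gt0// (lt_le_trans ltr01).
exists (2 * c); split => // f fM normf.
have ms := measurable_csquare_martingale Ffilt fM.
have s0 : forall w, (0 <= csquare P F f w)%E by exact: csquare_ge0.
have /choice[a /all_and2[ia aE]] := atom_exists Ffilt fM p.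
exists a, (level_coef P p (csquare P F f)); split; [|split; [|split; [|split; [|split; [|split]]]]].
- by move=> k; exact: (atom_is_atom Ffilt fM pexp (ia k) (aE k)).
- by move=> k; exact: (atom_norm Ffilt fM pexp (ia k) (aE k)).
- by move=> k; exact: level_coef_ge0.
- by move=> n; exact: (partial_sum_cvg Ffilt fM pexp normf aE).
- exact: (level_coef_lower pexp ms s0).
- apply: le_trans (level_coef_upper pexp ms s0 (csquare_lty_ae Ffilt fM pexp normf)) _.
  rewrite lee_wpmul2r ?poweR_ge0// lee_fin -[leLHS]mulr1 ler_wpM2l//.
- exact: (partial_sum_norm_cvg Ffilt fM pexp normf ia aE).
Qed.
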